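(* Let $\nu>0$ and $W(x)=x^2$, so that $\lambda_m^0=2(2m+1+\nu)h$ for each integer $m\ge0$, and let $\Lambda=(0,L)$ with $L>0$. Fix an integer $m\ge0$. Then for $L^{-2}h$ sufficiently small depending on $m$, $$\lambda_m^\Lambda=2(2m+1+\nu)h+\frac{4\,h^{-2m-\nu}\,L^{2(2m+1+\nu)}}{m!\,\Gamma(1+m+\nu)}\,e^{-L^2/h}\left(1+\mathcal{O}(L^{-2}h)\right).$$
   Context: $D_x=-i\,d/dx$, $h>0$, and $\nu>0$ is fixed. $\lambda_m^0$ is the $m$'th eigenvalue of the self-adjoint operator $Q(\nu;h)=h^2D_x^2+h^2(\nu^2-\tfrac14)x^{-2}+x^2$ on $L^2((0,\infty))$, where for $0<\nu<1$ the Friedrichs extension is used, equivalently the boundary condition $\lim_{x\to0}x^{\nu-1/2}u(x)=0$ is imposed. $\lambda_m^\Lambda$ is the $m$'th eigenvalue of the self-adjoint operator $Q_\Lambda(\nu;h)$ on $L^2((0,L))$ with the same differential expression, with Dirichlet boundary condition at $x=L$ and, when $0<\nu<1$, the boundary condition $\lim_{x\to0}x^{\nu-1/2}u(x)=0$. Eigenvalues are numbered from $m=0$ in increasing order. The implied constant in $\mathcal{O}(L^{-2}h)$ does not depend on $L$ or $h$. *)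

(* Defs.v *)
From HB Require Import structures.
From mathcomp Require Import all_boot all_order all_algebra.
From mathcomp Require Import all_classical all_reals all_analysis.
From mathcomp Require Import complex.

Set Implicit Arguments.
Unset Strict Implicit.
Unset Printing Implicit Defensive.
Import Order.TTheory GRing.Theory Num.Theory.
Import numFieldNormedType.Exports.
Local Open Scope classical_set_scope.
Local Open Scope ring_scope.
Local Open Scope complex_scope.

Section Definitions.
Context {R : realType}.
Local Notation mu := (@lebesgue_measure R).
Local Notation Re := complex.Re.
Local Notation Im := complex.Im.
Local Notation normc := ComplexField.Normc.normc.

Definition Gamma (s : R) : R :=
  \int[mu]_(t in `]0, +oo[) (t `^ (s - 1) * expR (- t)).

(* Elements of L^2(I) are represented by functions on the whole line, whose
   values outside I are irrelevant. *)
Definition L2 (I : set R) (u : R -> R[i]) : Prop :=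
  [/\ measurable_fun I (fun x => Re (u x)),
      measurable_fun I (fun x => Im (u x)) &
      (\int[mu]_(x in I) ((normc (u x)) ^+ 2)%:E < +oo)%E].

Definition L2_independent (I : set R) (n : nat) (u : 'I_n -> R -> R[i]) : Prop :=
  forall c : 'I_n -> R[i],
    {ae mu, forall x, I x -> \sum_(i < n) c i * u i x = 0} ->
    forall i, c i = 0.

(* f is locally absolutely continuous on the open interval I, with f' = g
   almost everywhere: f is an indefinite integral of the locally integrable g. *)
Definition AC_deriv (I : set R) (f g : R -> R) : Prop :=
  locally_integrable I g /\
  forall x y, I x -> I y -> x <= y -> f y - f x = \int[mu]_(t in `[x, y]) g t.

Definition AC_derivC (I : set R) (u v : R -> R[i]) : Prop :=
  AC_deriv I (fun x => Re (u x)) (fun x => Re (v x)) /\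
  AC_deriv I (fun x => Im (u x)) (fun x => Im (v x)).

(* A possibly unbounded operator on L^2(I) is given by its graph: A u f means
   that u is in the domain and A u = f. *)
Definition operator : Type := (R -> R[i]) -> (R -> R[i]) -> Prop.

(* The expression h^2 D_x^2 + h^2 (nu^2 - 1/4) x^-2 + x^2, with D_x = -i d/dx
   and hence D_x^2 u = - u'', on its maximal domain in L^2(I). *)
Definition Q_maximal (I : set R) (nu h : R) : operator := fun u f =>
  [/\ L2 I u, L2 I f &
      exists u1 u2 : R -> R[i],
        [/\ AC_derivC I u u1, AC_derivC I u1 u2 &
            {ae mu, forall x, I x ->
              f x = (h ^+ 2)%:C * - u2 x
                    + (h ^+ 2 * (nu ^+ 2 - 4^-1) * x ^- 2 + x ^+ 2)%:C * u x}]].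

(* For 0 < nu < 1 this selects the Friedrichs extension; for nu >= 1 the point
   x = 0 is of limit-point type and no condition is imposed. *)
Definition left_bc (nu : R) (u : R -> R[i]) : Prop :=
  nu < 1 -> x `^ (nu - 2^-1) * normc (u x) @[x --> 0^'+] --> (0 : R).

Definition Q_halfline (nu h : R) : operator := fun u f =>
  Q_maximal `]0, +oo[ nu h u f /\ left_bc nu u.

Definition Q_Lambda (nu h L : R) : operator := fun u f =>
  [/\ Q_maximal `]0, L[ nu h u f, left_bc nu u &
      normc (u x) @[x --> L^'-] --> (0 : R)].

Definition eigenfunction (A : operator) (lam : R) (u : R -> R[i]) : Prop :=
  A u (fun x => lam%:C * u x).

(* There are at least n eigenvalues in P, counted with multiplicity. *)
Definition has_eigenvalues (I : set R) (A : operator) (P : set R) (n : nat) :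
    Prop :=
  exists (lam : 'I_n -> R) (u : 'I_n -> R -> R[i]),
    (forall i, P (lam i) /\ eigenfunction A (lam i) (u i)) /\
    L2_independent I u.

(* In increasing order with multiplicity, numbered from 0: at least m + 1
   eigenvalues are <= lam and at most m are < lam. *)
Definition mth_eigenvalue (I : set R) (A : operator) (m : nat) (lam : R) :
    Prop :=
  has_eigenvalues I A [set e | e <= lam] m.+1 /\
  ~ has_eigenvalues I A [set e | e < lam] m.+1.

Lemma mth_eigenvalue_unique I A m lam1 lam2 :
  mth_eigenvalue I A m lam1 -> mth_eigenvalue I A m lam2 -> lam1 = lam2.
Proof.
have lt_absurd a b : a < b -> mth_eigenvalue I A m a ->
    ~ mth_eigenvalue I A m b.
  move=> ab [[l [u [lu fr]]] _] [_]; apply; exists l, u; split=> // i.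
  by have [/= la ?] := lu i; split=> //=; exact: le_lt_trans la ab.
move=> m1 m2; case: (ltgtP lam1 lam2) => // /lt_absurd H.
- by case: (H m1 m2).
- by case: (H m2 m1).
Qed.

Lemma mth_eigenvalue_eigen I A m lam : mth_eigenvalue I A m lam ->
  exists u, eigenfunction A lam u /\
    ~ {ae mu, forall x, I x -> u x = 0}.
Proof.
move=> [[l [u [lu fr]]] nlt].
have [i li] : exists i, l i = lam.
  apply: contrapT => /forallNP nl; apply: nlt; exists l, u; split=> // i.
  have [/= la ?] := lu i; split=> //=.
  by rewrite lt_neqAle la andbT; apply/eqP; exact: nl.
exists (u i); split; first by rewrite -li; have [] := lu i.
move=> u0; have /(_ _ i)/eqP := fr (fun j => (j == i)%:R).
rewrite eqxx oner_eq0 => H; suff: false by []; apply: H.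
apply: (@filterS _ _ (ae_filter_ringOfSetsType mu) _ _ _ u0) => x ux0 Ix; rewrite (bigD1 i)//= eqxx mul1r ux0// add0r.
by rewrite big1// => j /negPf ->; rewrite mul0r.
Qed.

End Definitions.

(* Main.v *)
Require Import Defs.
From HB Require Import structures.
From mathcomp Require Import all_boot all_order all_algebra.
From mathcomp Require Import all_classical all_reals all_analysis.
From mathcomp Require Import measurable_realfun complex ring lra.

Set Implicit Arguments.
Unset Strict Implicit.
Unset Printing Implicit Defensive.
Import Order.TTheory GRing.Theory Num.Theory.
Import numFieldNormedType.Exports.
Local Open Scope classical_set_scope.
Local Open Scope ring_scope.

(** Why the theorem holds.

    Every eigenfunction, for either problem, is a multiple of one explicit
    function.  With b = nu + 1 and a = (nu + 1)/2 - e/(4 h), the function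
      phi e x = x^(nu+1/2) exp(-x^2/(2h)) M(a, b, x^2/h),
    M being Kummer's confluent hypergeometric function, solves the eigenvalue
    equation and behaves like x^(nu+1/2) at the origin.  The Wronskian of a
    second solution u with phi is a constant w.  If w <> 0 then the derivative
    of u / phi is -w / phi^2, which forces |u| >= k x^(1/2-nu) near 0; this
    contradicts the boundary condition when nu < 1 and square integrability
    when nu >= 1.  So w = 0 and u is a multiple of phi e
    ([eigenfunction_regular]).  In particular all eigenvalues are simple, and
    eigenfunctions for distinct eigenvalues are independent
    ([phiC_independent]), so the m-th eigenvalue is found by listing the
    admissible values of a ([mth_eigenvalue_of_regular]).

    On the half line phi e is square integrable exactly when M(a, b, .) does
    not grow like exp(z), that is when a = -k for a natural number k
    ([kummer_growth], [kummer_poly_le]); this is e = 2 (2k + 1 + nu) h.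

    On (0, L) the remaining condition is M(a, b, z) = 0 with z = L^2/h.  Write
    a = -k - d with |d| <= 1/2.  The terms of M of degree at most k and those
    of larger degree have, up to the common factor (a)_k, opposite signs, the
    latter carrying the factor a + k = -d:
      M(-k-d, b, z) = (a)_k z^k (P(d) - d z S(d)),
    where P(d) -> 1/((b)_k k!) and S(d) is a power series in z with positive
    coefficients ([kummer_factor]).  The coefficients of S(0) agree up to a
    factor 1 + O(1/n) with those of a tail of M(1, b, z), the sum of
    z^n/(b)_n, so S(0) is that tail up to 1 + O(1/z).  Since S(0) exceeds
    every power of z, the balance P(d) = d z S(d) has exactly one solution,
    and it is tiny and positive ([kummer_zero_near]).  Finally
    z^nu exp(-z) (M(1, nu+1, z) - 1) has derivative z^nu exp(-z), hence tends
    to Gamma(nu+1) with error O(1/z) ([Gamma_igamma]).  Together these give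
      d = z^(2k+1+nu) exp(-z) / (k! Gamma(1+k+nu)) (1 + O(1/z)),
    and e = 2 (2 (k + d) + 1 + nu) h is the asserted expansion. *)

(** * Monotonicity from the derivative *)

Section Calculus.
Context {R : realType}.
Implicit Types (f df g : R -> R) (a b x y : R).

Lemma is_derive_continuous f (d x : R) :
  is_derive x 1 f d -> {for x, continuous f}.
Proof.
by move=> [fd _]; apply: differentiable_continuous; exact/derivable1_diffP.
Qed.

Lemma mean_value f df a b : a < b ->
  (forall x, a <= x <= b -> is_derive x 1 f (df x)) ->
  exists2 c, a < c < b & f b - f a = df c * (b - a).
Proof.
move=> ab fd.
have [||c cab ->] := @MVT R f df a b ab.
- move=> x; rewrite in_itv/= => /andP[ax xb]; apply: fd.
  by rewrite (ltW ax) (ltW xb).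
- apply: continuous_in_subspaceT => x; rewrite inE/= in_itv/= => xab.
  exact: is_derive_continuous (fd _ xab).
by exists c => //; move: cab; rewrite in_itv.
Qed.

Lemma derive_ge0_le f df a b : a <= b ->
  (forall x, a <= x <= b -> is_derive x 1 f (df x)) ->
  (forall x, a <= x <= b -> 0 <= df x) -> f a <= f b.
Proof.
rewrite le_eqVlt => /predU1P[-> //|ab] fd df0.
have [c /andP[ac cb] e] := mean_value ab fd.
by rewrite -subr_ge0 e mulr_ge0 ?df0 ?subr_ge0 ?(ltW ac) ?(ltW cb) ?(ltW ab).
Qed.

Lemma derive_eq0_eq f a b : a <= b ->
  (forall x, a <= x <= b -> is_derive x 1 f 0) -> f a = f b.
Proof.
rewrite le_eqVlt => /predU1P[-> //|ab] fd.
have [c _ /eqP] := @mean_value f (fun=> 0) a b ab fd.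
by rewrite mul0r subr_eq0 => /eqP.
Qed.

End Calculus.

(** * Entire power series *)

Section EntireSeries.
Context {R : realType}.
Implicit Types (c d : R^nat) (x y : R).

(** Factorial decay of the coefficients, rather than mere convergence: it is
    stable under all the coefficient operations used below, and it makes the
    sums comparable with exponentials. *)
Definition entire c :=
  exists A rho : R, forall n, `|c n| <= A * rho ^+ n / n`!%:R.

(** Total in [x]; it is only used for [entire] coefficient sequences, where the
    limit exists everywhere. *)
Definition psum c x : R := limn (pseries c x).

Lemma entire_ge0 c : entire c -> exists A rho : R,
  [/\ 0 <= A, 0 <= rho & forall n, `|c n| <= A * rho ^+ n / n`!%:R].
Proof.
move=> [A [rho H]]; exists `|A|, `|rho|; split => // n.
apply: (le_trans (H n)); rewrite ler_pM2r ?invr_gt0 ?ltr0n ?fact_gt0//.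
by rewrite -normrX -normrM ler_norm.
Qed.

Lemma cvg_exp_terms (A rho x : R) :
  cvgn (series (fun n => A * rho ^+ n / n`!%:R * x ^+ n)).
Proof.
rewrite (_ : (fun n => _) = A *: (exp_coeff (rho * x) : R^nat)); last first.
  by apply/funext => n; rewrite /exp_coeff /GRing.scale/= ?/GRing.scale/= exprMn; ring.
exact: is_cvg_seriesZ (is_cvg_series_exp_coeff _).
Qed.

Lemma entire_normed_cvg c x : entire c -> cvgn [normed pseries c x].
Proof.
move=> /entire_ge0[A [rho [A0 r0 H]]].
apply: (@series_le_cvg _ _ (fun n => A * rho ^+ n / n`!%:R * `|x| ^+ n)).
- by move=> n; exact: normr_ge0.
- by move=> n; rewrite !mulr_ge0 ?exprn_ge0 ?invr_ge0.
- by move=> n; rewrite /= normrM normrX ler_wpM2r.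
exact: cvg_exp_terms.
Qed.

Lemma entire_cvg c x : entire c -> cvgn (pseries c x).
Proof. by move=> /(@entire_normed_cvg _ x)/normed_cvg. Qed.

Lemma entire_le c d : (forall n, `|c n| <= `|d n|) -> entire d -> entire c.
Proof.
by move=> cd [A [rho H]]; exists A, rho => n; rewrite (le_trans (cd n)).
Qed.

Lemma entireD c d : entire c -> entire d -> entire (fun n => c n + d n).
Proof.
move=> /entire_ge0[A [r [A0 r0 H]]] /entire_ge0[B [s [B0 s0 K]]].
exists (A + B), (r + s) => n; rewrite (le_trans (ler_normD _ _))//.
rewrite mulrDl mulrDl lerD//.
- rewrite (le_trans (H n))// ler_wpM2r ?invr_ge0// ler_wpM2l//.
  by rewrite lerXn2r ?nnegrE ?addr_ge0// lerDl.
- rewrite (le_trans (K n))// ler_wpM2r ?invr_ge0// ler_wpM2l//.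
  by rewrite lerXn2r ?nnegrE ?addr_ge0// lerDr.
Qed.

Lemma entireZ (k : R) c : entire c -> entire (fun n => k * c n).
Proof.
move=> [A [r H]]; exists (`|k| * A), r => n.
by rewrite normrM -!mulrA ler_wpM2l// mulrA.
Qed.

Lemma entireB c d : entire c -> entire d -> entire (fun n => c n - d n).
Proof.
move=> ec ed; have := entireD ec (entireZ (-1) ed).
by congr entire; apply/funext => n; rewrite mulN1r.
Qed.

Lemma entire_diffs c : entire c -> entire (pseries_diffs c).
Proof.
move=> [A [r H]]; exists (A * r), r => n.
rewrite /pseries_diffs normrM normr_nat -ler_pdivlMl ?ltr0n//.
apply: (le_trans (H n.+1)).
by rewrite factS natrM invfM exprS le_eqVlt; apply/orP; left; apply/eqP; ring.
Qed.

Lemma entireS c : entire c -> entire (fun n => c n.+1).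
Proof.
move=> /entire_ge0[A [r [A0 r0 H]]]; exists (A * r), r => n.
apply: (le_trans (H n.+1)); rewrite exprS mulrA ler_wpM2l//.
  by rewrite !mulr_ge0// exprn_ge0.
by rewrite lef_pV2 ?posrE ?ltr0n ?fact_gt0// ler_nat factS leq_pmull.
Qed.

Lemma entire_mulX c : entire c -> entire (fun n => n%:R * c n).
Proof.
move=> /entire_ge0[A [r [A0 r0 H]]]; exists A, (r * 2) => n.
have n2 : (n%:R : R) <= 2 ^+ n by rewrite -natrX ler_nat ltnW// ltn_expl.
rewrite normrM normr_nat exprMn (_ : A * _ / _ = 2 ^+ n * (A * r ^+ n / n`!%:R)); last by ring.
by rewrite ler_pM.
Qed.

Lemma entire_exp (A r : R) : entire (fun n => A * r ^+ n / n`!%:R).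
Proof.
exists `|A|, `|r| => n.
by rewrite !normrM normrX normfV normr_nat.
Qed.

Lemma psum_is_derive c x : entire c ->
  is_derive x 1 (psum c) (psum (pseries_diffs c) x).
Proof.
move=> ec; apply: (@pseries_snd_diffs R c (`|x| + 1)).
- exact: entire_cvg.
- by apply: entire_cvg; exact: entire_diffs.
- by apply: entire_cvg; do 2 apply: entire_diffs.
- by rewrite [ltRHS]ger0_norm ?addr_ge0// ltrDl.
Qed.

Lemma psumD c d x : entire c -> entire d ->
  psum (fun n => c n + d n) x = psum c x + psum d x.
Proof.
move=> ec ed; rewrite /psum /pseries -lim_seriesD; [|exact: entire_cvg..].
by congr (limn (series _)); apply/funext => n; exact: mulrDl.
Qed.

Lemma psumZ (k : R) c x : entire c ->
  psum (fun n => k * c n) x = k * psum c x.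
Proof.
move=> ec.
rewrite /psum /pseries -[k * _]/(k *: _) -lim_seriesZ; last exact: entire_cvg.
by congr (limn (series _)); apply/funext => n; rewrite /GRing.scale/= ?/GRing.scale/= mulrA.
Qed.

Lemma psumB c d x : entire c -> entire d ->
  psum (fun n => c n - d n) x = psum c x - psum d x.
Proof.
move=> ec ed; rewrite -[in RHS]mulN1r -psumZ// -psumD//; last exact: entireZ.
by congr psum; apply/funext => n; rewrite mulN1r.
Qed.

Lemma psum_le c d x : 0 <= x -> entire c -> entire d ->
  (forall n, c n <= d n) -> psum c x <= psum d x.
Proof.
move=> x0 ec ed cd; apply: lim_series_le; [exact: entire_cvg..|].
by move=> n; rewrite ler_wpM2r// exprn_ge0.
Qed.

Lemma entire0 : entire (fun=> 0).
Proof. by exists 0, 0 => n; rewrite normr0 !mul0r. Qed.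

Lemma psum0 x : psum (fun=> 0) x = 0.
Proof.
rewrite -[RHS](mul0r (psum (fun=> 0) x)) -psumZ; last exact: entire0.
by congr psum; apply/funext => n; rewrite mul0r.
Qed.

Lemma psum_exp (A r x : R) :
  psum (fun n => A * r ^+ n / n`!%:R) x = A * expR (r * x).
Proof.
rewrite /psum /expR -[RHS]/(_ *: _) -lim_seriesZ; last exact: is_cvg_series_exp_coeff.
congr (limn (series _)); apply/funext => n.
by rewrite /exp_coeff /GRing.scale/= ?/GRing.scale/= exprMn; ring.
Qed.

Lemma psumS c x : entire c -> psum c x = c 0%N + x * psum (fun n => c n.+1) x.
Proof.
move=> ec.
have h1 := @entire_cvg c x ec; have h2 := @entire_cvg _ x (entireS ec).
have : series (fun n => c n * x ^+ n) n.+1 @[n --> \oo] --> psum c x.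
  by rewrite (cvg_shiftS (pseries c x)); exact: h1.
have -> : (fun n => series (fun n => c n * x ^+ n) n.+1) =
   (fun n => c 0%N + x * pseries (fun n => c n.+1) x n).
  apply/funext => n; rewrite /pseries /series/= big_nat_recl//= expr0 mulr1.
  by rewrite mulr_sumr; congr (_ + _); apply: eq_bigr => i _; rewrite exprS; ring.
move=> h; apply: (cvg_unique _ h) => //.
by apply: cvgD; [exact: cvg_cst|apply: cvgMr].
Qed.

Lemma entireSn c N : entire c -> entire (fun n => c (N + n)%N).
Proof.
move=> ec; elim: N => [//|N /entireS].
by under eq_fun do rewrite addnS.
Qed.

(** The splitting is exact, which lets the terms of low degree be treated
    algebraically and the remainder as a positive series. *)
Lemma psum_split c N x : entire c ->
  psum c x = \sum_(i < N) c i * x ^+ i + x ^+ N * psum (fun n => c (N + n)%N) x.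
Proof.
move=> ec; elim: N => [|N ->]; first by rewrite big_ord0 add0r mul1r.
rewrite psumS; last exact: entireSn.
rewrite big_ord_recr/= addn0 -addrA mulrDr; congr (_ + _).
rewrite [c N * _]mulrC; congr (_ + _).
by under [in RHS]eq_fun do rewrite addSnnS; rewrite exprSr mulrA.
Qed.

Lemma psum_at0 c : entire c -> psum c 0 = c 0%N.
Proof. by move=> ec; rewrite psumS// mul0r addr0. Qed.

Lemma psum_ge0 c x : 0 <= x -> entire c -> (forall n, 0 <= c n) ->
  0 <= psum c x.
Proof.
move=> x0 ec c0; rewrite -(psum0 x); apply: psum_le => //.
exact: entire0.
Qed.

Lemma psum_ge_term c n x : 0 <= x -> entire c -> (forall n, 0 <= c n) ->
  c n * x ^+ n <= psum c x.
Proof.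
move=> x0 ec c0; rewrite (psum_split n.+1 x ec) big_ord_recr/= -addrA addrCA.
rewrite lerDl addr_ge0//.
  by apply: sumr_ge0 => i _; rewrite mulr_ge0// exprn_ge0.
by rewrite mulr_ge0 ?exprn_ge0// psum_ge0//; exact: entireSn.
Qed.

Lemma psum_continuous c : entire c -> continuous (psum c).
Proof. by move=> ec x; apply: is_derive_continuous (psum_is_derive x ec). Qed.

End EntireSeries.

(** * Rising factorials *)

Section Pochhammer.
Context {R : realType}.
Implicit Types (a b : R) (n m : nat).

Definition poch a n : R := \prod_(i < n) (a + i%:R).

Lemma poch0 a : poch a 0 = 1. Proof. by rewrite /poch big_ord0. Qed.

Lemma pochS a n : poch a n.+1 = poch a n * (a + n%:R).
Proof. by rewrite /poch big_ord_recr. Qed.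

Lemma pochD a m n : poch a (m + n) = poch a m * poch (a + m%:R) n.
Proof.
elim: n => [|n IH]; first by rewrite addn0 poch0 mulr1.
by rewrite addnS !pochS IH natrD -!mulrA addrA.
Qed.

Lemma poch_recl a n : poch a n.+1 = a * poch (a + 1) n.
Proof. by rewrite -[n.+1]add1n pochD pochS poch0 mul1r addr0. Qed.

Lemma poch_gt0 a n : 0 < a -> 0 < poch a n.
Proof. by move=> a0; apply: prodr_gt0 => i _; rewrite ltr_pwDl. Qed.

Lemma poch_neq0 a n : (forall i, (i < n)%N -> a + i%:R != 0) -> poch a n != 0.
Proof. by move=> H; apply/prodf_neq0 => i _; exact: H. Qed.

Lemma poch1 n : poch 1 n = n`!%:R.
Proof.
by elim: n => [|n IH]; rewrite ?poch0// pochS IH factS natrM mulrC -natr1 addrC.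
Qed.

Lemma fact_poch n m : ((n + m)`!%:R : R) = n`!%:R * poch (n%:R + 1) m.
Proof. by rewrite -!poch1 pochD addrC. Qed.

Lemma poch_le a b n : 0 <= a -> a <= b -> poch a n <= poch b n.
Proof.
by move=> a0 ab; apply: ler_prod => i _; rewrite addr_ge0// lerD2r.
Qed.

End Pochhammer.

(** * Kummer's function M(a, b, z) *)

Section Kummer.
Context {R : realType}.
Implicit Types (a b x y z : R) (n m : nat).

Definition kummer_coef a b n : R := poch a n / (poch b n * n`!%:R).
Definition kummer a b : R -> R := psum (kummer_coef a b).

(** The factors satisfy |a + i| <= (1 + |a|/b) (b + i). *)
Lemma poch_ratio_le a b n : 0 < b ->
  `|poch a n| / poch b n <= (1 + `|a| / b) ^+ n.
Proof.
move=> b0; elim: n => [|n IH]; first by rewrite !poch0 normr1 divr1.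
have bn : 0 < b + n%:R by rewrite ltr_pwDl.
rewrite !pochS normrM invfM mulrACA exprSr ler_pM// ?mulr_ge0// ?invr_ge0.
- by rewrite ltW ?poch_gt0.
- by rewrite ltW.
rewrite ler_pdivrMr// (le_trans (ler_normD _ _))// normr_nat.
rewrite mulrDl mul1r mulrDr divfK ?gt_eqF//.
rewrite -addrA [leLHS]addrC -subr_ge0.
have -> : b + (n%:R + (`|a| + `|a| / b * n%:R)) - (n%:R + `|a|) =
  b + `|a| / b * n%:R by ring.
by rewrite addr_ge0 ?(ltW b0)// mulr_ge0// divr_ge0// ltW.
Qed.

Lemma entire_kummer a b : 0 < b -> entire (kummer_coef a b).
Proof.
move=> b0; exists 1, (1 + `|a| / b) => n; have bn := poch_gt0 n b0.
rewrite /kummer_coef invfM mulrA !normrM mul1r !normfV normr_nat.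
by rewrite ler_wpM2r ?invr_ge0// (gtr0_norm bn) poch_ratio_le.
Qed.

(** The recurrence equivalent, coefficient by coefficient, to Kummer's
    differential equation. *)
Lemma kummer_coefS a b n : 0 < b ->
  (n%:R + 1) * (b + n%:R) * kummer_coef a b n.+1
    = (a + n%:R) * kummer_coef a b n.
Proof.
move=> b0; have bn : b + n%:R != 0 by rewrite gt_eqF// ltr_pwDl.
have n1 : (n%:R + 1 : R) != 0 by rewrite gt_eqF// ltr_wpDl.
have nf : (n`!%:R : R) != 0 by rewrite pnatr_eq0 -lt0n fact_gt0.
have bp : poch b n != 0 by rewrite gt_eqF// poch_gt0.
rewrite /kummer_coef !pochS factS natrM -natr1; field.
by rewrite bp nf bn n1.
Qed.

Definition kummer1 a b : R -> R := psum (pseries_diffs (kummer_coef a b)).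
Definition kummer2 a b : R -> R :=
  psum (pseries_diffs (pseries_diffs (kummer_coef a b))).

Lemma kummer_is_derive a b z : 0 < b ->
  is_derive z 1 (kummer a b) (kummer1 a b z).
Proof. by move=> b0; apply: psum_is_derive; exact: entire_kummer. Qed.

Lemma kummer1_is_derive a b z : 0 < b ->
  is_derive z 1 (kummer1 a b) (kummer2 a b z).
Proof.
by move=> b0; apply: psum_is_derive; apply: entire_diffs; exact: entire_kummer.
Qed.

(** Comparing coefficients is easiest for the operator z d/dz, which acts
    diagonally. *)
Lemma psum_mulX (c : R^nat) z : entire c ->
  z * psum (pseries_diffs c) z = psum (fun n => n%:R * c n) z.
Proof.
move=> ec; rewrite [RHS]psumS; last exact: entire_mulX.
by rewrite mul0r add0r.
Qed.

Lemma kummer_ode a b z : 0 < b ->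
  z * kummer2 a b z = a * kummer a b z - (b - z) * kummer1 a b z.
Proof.
move=> b0; have e0 := entire_kummer a b0; have e1 := entire_diffs e0.
suff e : z * kummer2 a b z + b * kummer1 a b z =
    z * kummer1 a b z + a * kummer a b z.
  by rewrite -[LHS](addrK (b * kummer1 a b z)) e; ring.
rewrite /kummer2 /kummer1 /kummer !psum_mulX// -!psumZ// -!psumD//.
- congr psum; apply/funext => n; rewrite /pseries_diffs -!mulrDl.
  by rewrite [n%:R + a]addrC -kummer_coefS// -natr1; ring.
- exact: entire_mulX.
- exact: entireZ.
- exact: entire_mulX.
- exact: entireZ.
Qed.

(** This is what confines the zeros in [a] to negative values. *)
Lemma kummer_gt0 a b z : 0 <= a -> 0 < b -> 0 <= z -> 0 < kummer a b z.
Proof.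
move=> a0 b0 z0; have e0 := entire_kummer a b0.
apply: (@lt_le_trans _ _ (kummer_coef a b 0 * z ^+ 0)).
  by rewrite /kummer_coef !poch0 fact0 expr0 !mulr1 invr1.
apply: psum_ge_term => // n.
rewrite divr_ge0 ?mulr_ge0//; last by rewrite ltW ?poch_gt0.
by apply: prodr_ge0 => i _; rewrite addr_ge0.
Qed.

Lemma kummer0 a b : 0 < b -> kummer a b 0 = 1.
Proof.
move=> b0; rewrite /kummer psum_at0; last exact: entire_kummer.
by rewrite /kummer_coef !poch0 fact0 mulr1 divr1.
Qed.

End Kummer.

(** * The series M(1, b, z) and its tails *)

Section TailSeries.
Context {R : realType}.
Implicit Types (b z : R) (n j : nat).

(** For [j = 0] this is M(1, b, z); in general [z ^ j * poch_tail b j z] is what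
    remains of M(1, b, z) after its first [j] terms.  The sums S(d) below are
    compared with these tails because multiplying a coefficient by
    1/((b+n)...(b+n+j-1)) is exactly a shift by [j]. *)
Definition poch_tail b j : R -> R := psum (fun n => (poch b (j + n))^-1).

Lemma entire_poch_tail b j : 0 < b -> entire (fun n => (poch b (j + n))^-1).
Proof.
move=> b0; apply: (@entireSn _ (fun n => (poch b n)^-1)).
apply: (@entire_le _ _ (kummer_coef 1 b)); last exact: entire_kummer.
move=> n; rewrite /kummer_coef poch1 invfM mulrCA mulfV ?mulr1// pnatr_eq0 -lt0n fact_gt0.
Qed.

Lemma poch_tailS b j z : 0 < b -> poch_tail b j z = (poch b j)^-1 + z * poch_tail b j.+1 z.
Proof.
move=> b0; rewrite /poch_tail psumS; last exact: entire_poch_tail.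
by rewrite addn0; under [in RHS]eq_fun do rewrite addSnnS.
Qed.

Lemma poch_tail_split b j z : 0 < b ->
  poch_tail b 0 z = \sum_(i < j) (poch b i)^-1 * z ^+ i + z ^+ j * poch_tail b j z.
Proof.
move=> b0; rewrite /poch_tail (psum_split j); last exact: entire_poch_tail.
by congr (_ + _).
Qed.

Lemma poch_tail_ge b j n z : 0 < b -> 0 <= z ->
  z ^+ n / poch b (j + n) <= poch_tail b j z.
Proof.
move=> b0 z0; rewrite mulrC.
apply: (@psum_ge_term _ (fun n => (poch b (j + n))^-1)) => //.
  exact: entire_poch_tail.
by move=> i; rewrite invr_ge0 ltW// poch_gt0.
Qed.

Lemma poch_tail_gt0 b j z : 0 < b -> 0 <= z -> 0 < poch_tail b j z.
Proof.
move=> b0 z0; apply: lt_le_trans (poch_tail_ge j 0 b0 z0).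
by rewrite expr0 mul1r invr_gt0 poch_gt0.
Qed.

End TailSeries.

(** * Relative errors of order 1/z *)

Section RelativeError.
Context {R : realType}.
Implicit Types (C D x y z : R).

(** The statement x = 1 + O(1/z) with explicit constant. *)
Definition near_one C z x := `|x - 1| <= C / z.

Lemma near_oneM C D z x y : 1 <= z -> 0 <= C -> 0 <= D ->
  near_one C z x -> near_one D z y -> near_one (C + D + C * D) z (x * y).
Proof.
move=> z1 C0 D0; rewrite /near_one => xC yD.
have z0 : 0 < z by exact: lt_le_trans z1.
have -> : x * y - 1 = (x - 1) + (y - 1) + (x - 1) * (y - 1) by ring.
rewrite [leRHS]mulrDl [in leRHS]mulrDl (le_trans (ler_normD _ _))// lerD//.
  by rewrite (le_trans (ler_normD _ _))// lerD.
rewrite normrM; apply: (le_trans (ler_pM _ _ xC yD)) => //.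
rewrite mulrACA ler_wpM2l ?mulr_ge0// ger_pMl ?invr_gt0//.
by rewrite invf_le1.
Qed.

Lemma near_oneV C z x : 0 < z -> 0 <= C -> 2 * C <= z ->
  near_one C z x -> near_one (2 * C) z x^-1.
Proof.
move=> z0 C0 Cz; rewrite /near_one => xC.
have Cz2 : C / z <= 2^-1 by rewrite ler_pdivrMr// ler_pdivlMl.
have x2 : 2^-1 <= x.
  have := le_trans xC Cz2; rewrite ler_norml => /andP[+ _]; lra.
have x0 : 0 < x by lra.
have -> : x^-1 - 1 = - (x - 1) / x by field; rewrite gt_eqF.
rewrite normrM normrN normfV (gtr0_norm x0) ler_pdivrMr//.
apply: (le_trans xC); rewrite -mulrA mulrC -mulrA mulrCA.
have := divr_ge0 C0 (ltW z0); nra.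
Qed.

End RelativeError.

Section LipschitzIVT.
Context {R : realType}.

Lemma lipschitz_IVT (f : R -> R) (a b C : R) : a <= b -> 0 <= C ->
  (forall x y, a <= x -> x <= y -> y <= b -> `|f x - f y| <= C * (y - x)) ->
  0 <= f a -> f b <= 0 -> exists2 c, a <= c <= b & f c = 0.
Proof.
move=> ab C0 H fa fb.
have [||c] := @IVT R f a b 0 ab.
- apply/subspace_continuousP => x /=; rewrite in_itv/= => /andP[ax xb].
  apply/cvgrPdist_lt => e e0; rewrite near_withinE.
  near=> y => /=; rewrite in_itv/= => /andP[ay yb].
  apply: (@le_lt_trans _ _ (C * `|x - y|)).
    have [xy|yx] := leP x y.
      by rewrite (le_trans (H _ _ _ _ _))// ler_wpM2l// distrC ler_norm.
    rewrite distrC (le_trans (H _ _ _ (ltW yx) _))// ler_wpM2l// ler_norm//.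
  apply: (@le_lt_trans _ _ ((C + 1) * `|x - y|)).
    by rewrite ler_wpM2r// lerDl.
  rewrite mulrC -ltr_pdivlMr ?ltr_wpDl//.
  near: y; apply: (@cvgr_dist_lt _ _ _ (nbhs x) _ id x); first exact: cvg_id.
  by rewrite divr_gt0// ltr_wpDl.
- by rewrite ge_min le_max fa fb orbT.
by rewrite in_itv/= => cab fc; exists c.
Unshelve. all: by end_near. Qed.

End LipschitzIVT.

(** * Zeros of M(., b, z) near a nonpositive integer *)

Section ZerosNearInteger.
Context {R : realType}.
Variables (b : R) (k : nat).
Hypothesis b_gt0 : 0 < b.
Implicit Types (d z : R) (n i j : nat).

Let a d : R := - k%:R - d.

(** The coefficient of z^i in M(-k-d, b, z) for i <= k, divided by (a)_k with
    a = -k - d.  The quotient (a)_i / (a)_k is the inverse of a product of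
    k - i factors, none of which vanishes for |d| <= 1/2. *)
Definition low_coef d i : R :=
  (poch b i * i`!%:R)^-1 / poch (- (k - i)%:R - d) (k - i).

Definition low_part d z : R := \sum_(i < k.+1) z^-1 ^+ (k - i) * low_coef d i.

(** The coefficient of z^(k+1+n) in M(-k-d, b, z), divided by
    (a)_k (a + k) = - (a)_k d.  It is positive for d < 1. *)
Definition high_coef d n : R :=
  poch (1 - d) n / (poch b (k.+1 + n) * (k.+1 + n)`!%:R).

Definition high_part d z : R := psum (high_coef d) z.

Lemma poch_near_neq0 d j : `|d| <= 2^-1 -> poch (- j%:R - d) j != 0.
Proof.
move=> d2; apply: poch_neq0 => i ij; rewrite lt_eqF//.
have : (i%:R + 1 : R) <= j%:R by rewrite natr1 ler_nat.
move: d2; rewrite ler_norml => /andP[]; lra.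
Qed.

Lemma kummer_coef_high d n : kummer_coef (a d) b (k.+1 + n) =
  - (poch (a d) k * d) * high_coef d n.
Proof.
rewrite /kummer_coef /high_coef pochD pochS.
have -> : a d + k.+1%:R = 1 - d by rewrite /a -natr1; ring.
have -> : a d + k%:R = - d by rewrite /a; ring.
ring.
Qed.

Lemma entire_high_coef d : entire (high_coef d).
Proof.
have [A [r H]] : entire (fun n => kummer_coef (1 - d) 1 n).
  exact: entire_kummer.
apply: (@entire_le _ _ (fun n => (poch b k.+1)^-1 * ((fun n => kummer_coef (1-d) (b + k.+1%:R) n) n))); last first.
  by apply: entireZ; apply: entire_kummer; rewrite ltr_wpDr.
move=> n; rewrite /high_coef /kummer_coef pochD mulrCA -invfM -mulrA.
rewrite !normrM ler_wpM2l// !normfV lef_pV2 ?posrE; last first.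
- by rewrite normr_gt0 ?mulf_neq0// ?gt_eqF ?poch_gt0 ?ltr0n ?fact_gt0// ltr_wpDr.
- by rewrite normr_gt0 !mulf_neq0// ?gt_eqF ?poch_gt0 ?ltr0n ?fact_gt0// ltr_wpDr.
by rewrite !normrM !ler_wpM2l// !normr_nat ler_nat leq_fact// leq_addl.
Qed.

(** The decomposition behind the whole asymptotic analysis: a zero of M near
    a = -k is a balance between P(d), which is of order 1, and d z S(d), where
    S(d) is positive and exponentially large in z. *)
Lemma kummer_factor d z : 0 < z -> `|d| <= 2^-1 ->
  kummer (a d) b z = poch (a d) k * z ^+ k * (low_part d z - d * (z * high_part d z)).
Proof.
move=> z0 d2; rewrite /kummer (psum_split k.+1); last exact: entire_kummer.
have -> : (fun n => kummer_coef (a d) b (k.+1 + n)) =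
    (fun n => - (poch (a d) k * d) * high_coef d n).
  by apply/funext => n; rewrite kummer_coef_high.
rewrite psumZ; last exact: entire_high_coef.
rewrite mulrBr -/(high_part d z) exprS; congr (_ + _); last by ring.
rewrite /low_part mulr_sumr; apply: eq_bigr => -[i ik] _ /=.
rewrite ltnS in ik; rewrite /kummer_coef /low_coef.
have -> : poch (a d) k = poch (a d) i * poch (- (k - i)%:R - d) (k - i).
  rewrite -{1}(subnKC ik) pochD; congr (_ * poch _ _).
  by rewrite /a natrB//; ring.
have -> : z ^+ k = z ^+ i * z ^+ (k - i) by rewrite -exprD subnKC.
have := @poch_near_neq0 d (k - i) d2; set p := poch _ (k - i) => p0.
have zn0 : z ^+ (k - i) != 0 by rewrite expf_neq0// gt_eqF.
rewrite exprVn; set u := z ^+ (k - i) in zn0 *.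
rewrite mulrA -[RHS]mulrA.
set w := (poch b i * _)^-1.
by field; rewrite p0 zn0.
Qed.

(** The product is, up to sign, that of the factors d + 1, ..., d + j, each of
    modulus at least 1/2. *)
Lemma poch_inv_lipschitz j : exists2 C : R, 0 <= C &
  forall d d', `|d| <= 2^-1 -> `|d'| <= 2^-1 ->
  `|(poch (- j%:R - d) j)^-1| <= C /\
  `|(poch (- j%:R - d) j)^-1 - (poch (- j%:R - d') j)^-1| <= C * `|d - d'|.
Proof.
elim: j => [|j [C C0 IH]].
  by exists 1 => // d d' _ _; rewrite !poch0 subrr invr1 normr1 normr0 mul1r.
exists (2 * C + 4 * C); first by rewrite addr_ge0// mulr_ge0.
move=> d d' d2 d2'; have [h1 h2] := IH d d' d2 d2'.
have [h1' _] := IH d' d d2' d2.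
have e (x : R) : poch (- j.+1%:R - x) j.+1 = (- j.+1%:R - x) * poch (- j%:R - x) j.
  by rewrite poch_recl; congr (_ * poch _ _); rewrite -natr1; ring.
rewrite !e !invfM.
have lb (x : R) : `|x| <= 2^-1 -> 2^-1 <= `|- j.+1%:R - x|.
  rewrite ler_norml => /andP[x1 x2]; rewrite -opprD normrN.
  have : (1 : R) <= j.+1%:R by rewrite ler1n.
  by move=> j1; rewrite ger0_norm; lra.
have := lb _ d2; have := lb _ d2'.
set u := - _ - d'; set v := - _ - d => u2 v2.
have v0 : v != 0 by rewrite -normr_gt0; lra.
have u0 : u != 0 by rewrite -normr_gt0; lra.
have vi : `|v^-1| <= 2 by rewrite normfV -[leRHS]invrK lef_pV2 ?posrE// ?normr_gt0// invr_gt0.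
have ui : `|u^-1| <= 2 by rewrite normfV -[leRHS]invrK lef_pV2 ?posrE// ?normr_gt0// invr_gt0.
have uv : `|v^-1 - u^-1| <= 4 * `|d - d'|.
  have -> : v^-1 - u^-1 = v^-1 * u^-1 * (d - d').
    have -> : d - d' = u - v by rewrite /u /v; ring.
    by field; rewrite u0 v0.
  rewrite normrM ler_wpM2r// normrM; have -> : 4 = 2 * 2 :> R by ring.
  exact: ler_pM.
set p := (poch _ _)^-1 in h1 h2 *; set q := (poch _ _)^-1 in h1' h2 *.
split.
  rewrite normrM; apply: (@le_trans _ _ (2 * C)); first exact: ler_pM.
  by rewrite lerDl mulr_ge0.
have -> : v^-1 * p - u^-1 * q = v^-1 * (p - q) + (v^-1 - u^-1) * q by ring.
rewrite (le_trans (ler_normD _ _))// [leRHS]mulrDl lerD// normrM.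
- by rewrite -mulrA ler_pM.
- by rewrite mulrAC ler_pM.
Qed.

(** The value of [low_coef] at i = k, the only index that survives as z grows. *)
Definition low_limit : R := (poch b k * k`!%:R)^-1.

Lemma low_limit_gt0 : 0 < low_limit.
Proof. by rewrite invr_gt0 mulr_gt0 ?poch_gt0// ltr0n fact_gt0. Qed.

Lemma low_part_estimate : exists2 C : R, 0 <= C &
  forall z d d', 1 <= z -> `|d| <= 2^-1 -> `|d'| <= 2^-1 ->
  `|low_part d z - low_limit| <= C / z /\ `|low_part d z - low_part d' z| <= C * `|d - d'|.
Proof.
have H j : exists C : R, 0 <= C /\ forall d d', `|d| <= 2^-1 -> `|d'| <= 2^-1 ->
  `|low_coef d j| <= C /\ `|low_coef d j - low_coef d' j| <= C * `|d - d'|.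
  have [C C0 HC] := poch_inv_lipschitz (k - j).
  exists (`|(poch b j * j`!%:R)^-1| * C); split; first by rewrite mulr_ge0.
  move=> d d' d2 d2'; have [h1 h2] := HC _ _ d2 d2'.
  split; first by rewrite /low_coef normrM ler_wpM2l.
  by rewrite /low_coef -mulrBr normrM -mulrA ler_wpM2l.
have [C HC] := choice H.
have C0 j : 0 <= C j by have [] := HC j.
exists (\sum_(i < k.+1) C i); first by apply: sumr_ge0.
move=> z d d' z1 d2 d2'.
have zi : 0 <= z^-1 <= 1 by rewrite invr_ge0 invf_le1 ?(le_trans ler01 z1) ?(lt_le_trans ltr01 z1)//.
split.
  rewrite /low_part big_ord_recr/= subnn expr0 mul1r.
  have -> : low_coef d k = low_limit by rewrite /low_coef subnn poch0 divr1.
  rewrite addrK big_ord_recr/= mulrDl.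
  apply: (@le_trans _ _ ((\sum_(i < k) C i) / z)); last first.
    by rewrite lerDl mulr_ge0//; case/andP: zi.
  rewrite (le_trans (ler_norm_sum _ _ _))// mulr_suml ler_sum// => -[i ik] _ /=.
  have [_ /(_ d d' d2 d2')[h _]] := HC i.
  rewrite normrM mulrC ler_pM// ger0_norm ?exprn_ge0//; last by case/andP: zi.
  have -> : (k - i)%N = (k - i).-1.+1 by rewrite prednK// subn_gt0.
  rewrite exprS ler_piMr//; first by case/andP: zi.
  by case/andP: zi => *; exact: exprn_ile1.
rewrite /low_part -sumrB (le_trans (ler_norm_sum _ _ _))// mulr_suml ler_sum// => -[i ik] _ /=.
have [_ /(_ d d' d2 d2')[_ h]] := HC i.
rewrite -mulrBr normrM -[leRHS]mul1r ler_pM// normrX; case/andP: zi => *.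
by rewrite exprn_ile1// ger0_norm.
Qed.

Let N := (k.+1 + k.+1)%N.
Let T z := poch_tail b N z.

(** Each factor of the left product exceeds the matching one on the right by a
    factor at most 1 + c/(n+1), and such factors multiply. *)
Lemma poch_shift_ratio (c : R) j : 0 <= c -> exists2 C : R, 0 <= C &
  forall n, poch (c + (n%:R + 1)) j <= poch (n%:R + 1) j * (1 + C / (n%:R + 1)).
Proof.
move=> c0; elim: j => [|j [C C0 IH]].
  by exists 0 => // n; rewrite !poch0 mul0r addr0 mulr1.
exists (C + c + C * c); first by rewrite !addr_ge0// mulr_ge0.
move=> n; have n1 : 0 < (n%:R + 1 : R) by rewrite ltr_wpDl.
have pn := poch_gt0 j n1.
rewrite !pochS; apply: (@le_trans _ _ (poch (n%:R + 1) j * (1 + C / (n%:R + 1)) *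
  ((n%:R + 1 + j%:R) * (1 + c / (n%:R + 1))))).
  rewrite ler_pM//.
  - by rewrite ltW// poch_gt0// ltr_wpDl.
  - by rewrite !addr_ge0.
  rewrite mulrDr mulr1 -addrA [leLHS]addrC lerD2l mulrCA -{1}[c]mulr1 ler_wpM2l//.
  by rewrite ler_pdivlMr// mul1r lerDl.
rewrite mulrACA ler_wpM2l ?mulr_ge0 ?addr_ge0// ?(ltW pn)//.
set t := (n%:R + 1)^-1.
have t0 : 0 <= t by rewrite invr_ge0 ltW.
have t1 : t <= 1 by rewrite invf_le1// lerDr.
have tt : t * t <= t by rewrite ger_pMr// invr_gt0.
have := ler_wpM2l (mulr_ge0 C0 c0) tt; nra.
Qed.

Let NE n : (N + n = (k.+1 + n) + k.+1)%N.
Proof. by rewrite /N addnAC. Qed.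

Let bk_gt0 n : 0 < b + (k.+1 + n)%:R.
Proof. by rewrite ltr_wpDr. Qed.

Let fact_shift n : ((k.+1 + n)`!%:R : R) = n`!%:R * poch (n%:R + 1) k.+1.
Proof. by rewrite addnC fact_poch. Qed.

Let n1_gt0 n : 0 < (n%:R + 1 : R).
Proof. by rewrite ltr_wpDl. Qed.

Lemma high_coef0E n :
  high_coef 0 n = (poch b (k.+1 + n))^-1 * (poch (n%:R + 1) k.+1)^-1.
Proof.
rewrite /high_coef subr0 poch1 fact_shift.
have nf : (n`!%:R : R) != 0 by rewrite pnatr_eq0 -lt0n fact_gt0.
have h1 : poch (n%:R + 1) k.+1 != 0 :> R by rewrite gt_eqF// poch_gt0.
have h2 : poch b (k.+1 + n) != 0 by rewrite gt_eqF// poch_gt0.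
by field; rewrite nf h1 h2.
Qed.

(** Together with [high_coef0_le] this says that the coefficients of S(0) are
    those of the tail [T], up to 1 + O(1/n). *)
Lemma high_coef0_ge n : (poch b (N + n))^-1 <= high_coef 0 n.
Proof.
rewrite high_coef0E NE pochD invfM ler_wpM2l ?invr_ge0 ?(ltW (poch_gt0 _ b_gt0))//.
rewrite lef_pV2 ?posrE ?poch_gt0//.
apply: poch_le; first exact: ltW.
by rewrite natrD -natr1; have := ler0n R k; move: b_gt0; lra.
Qed.

Lemma high_coef0_le : exists2 C : R, 0 <= C & forall n,
  high_coef 0 n <= (poch b (N + n))^-1 * (1 + C / (n%:R + 1)).
Proof.
have [C C0 H] := @poch_shift_ratio (b + k%:R) k.+1 (addr_ge0 (ltW b_gt0) (ler0n _ _)).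
exists C => // n; have := H n.
have -> : b + k%:R + (n%:R + 1) = b + (k.+1 + n)%:R by rewrite natrD -natr1; ring.
rewrite high_coef0E NE [poch b (_ + _ + _)]pochD invfM => h.
rewrite -mulrA ler_wpM2l ?invr_ge0 ?(ltW (poch_gt0 _ b_gt0))//.
by rewrite ler_pdivlMl ?poch_gt0// ler_pdivrMr ?poch_gt0// mulrC.
Qed.

Lemma high_part0_ge z : 0 <= z -> T z <= high_part 0 z.
Proof.
by move=> z0; apply: psum_le => //; [exact: entire_poch_tail|exact: entire_high_coef|exact: high_coef0_ge].
Qed.

Lemma mul_poch_tail_le z : 0 <= z -> z * poch_tail b N.+1 z <= T z.
Proof.
by move=> z0; rewrite /T [leRHS]poch_tailS// lerDr invr_ge0 ltW// poch_gt0.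
Qed.

Lemma T_gt0 z : 0 <= z -> 0 < T z.
Proof. by move=> z0; exact: poch_tail_gt0. Qed.

(** The error term C/(n+1) in the coefficients turns into C/z in the sum,
    because dividing the coefficient by b + N + n shifts the tail by one. *)
Lemma high_part0_le : exists2 C : R, 0 <= C & forall z, 1 <= z ->
  high_part 0 z <= T z * (1 + C / z).
Proof.
have [C C0 H] := high_coef0_le.
have bN : 0 < b + N%:R by rewrite ltr_wpDr.
exists (C * (b + N%:R)); first by rewrite mulr_ge0// ltW.
move=> z z1; have z0 : 0 < z by exact: lt_le_trans z1.
apply: (@le_trans _ _ (T z + C * (b + N%:R) * poch_tail b N.+1 z)); last first.
  have h : poch_tail b N.+1 z <= T z / z by rewrite ler_pdivlMr// mulrC mul_poch_tail_le// ltW.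
  rewrite [leRHS](_ : _ = T z + C * (b + N%:R) * (T z / z)); last by ring.
  by rewrite lerD2l ler_wpM2l// mulr_ge0// ltW.
rewrite /T /poch_tail -psumZ -?psumD; try exact: entire_poch_tail; last first.
  by apply: entireZ; exact: entire_poch_tail.
apply: psum_le; [exact: ltW|exact: entire_high_coef| |].
  by apply: entireD; [|apply: entireZ]; exact: entire_poch_tail.
move=> n; apply: (le_trans (H n)); rewrite mulrDr mulr1 lerD2l mulrCA -!mulrA.
rewrite ler_wpM2l// addSn pochS invfM mulrCA ler_wpM2l ?invr_ge0 ?(ltW (poch_gt0 _ b_gt0))//.
have Nn : 0 < b + (N + n)%:R by rewrite ltr_wpDr.
rewrite ler_pdivlMr// mulrC ler_pdivrMr// natrD mulrDr mulr1.
have : 1 <= (N%:R : R) by rewrite ler1n.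
by have := ler0n R n; move: b_gt0; nra.
Qed.

Lemma poch_fact_le d n : 0 <= d -> d <= 2^-1 -> poch (1 - d) n <= n`!%:R.
Proof. by move=> d0 d1; rewrite -poch1 poch_le//; lra. Qed.

(** Half-integer rising factorials lose only a factor linear in n, so the
    series S(d) stays larger than every power of z for all d <= 1/2. *)
Lemma poch_fact_ge d n : d <= 2^-1 ->
  n`!%:R / (2 * (n%:R + 1)) <= poch (1 - d) n.
Proof.
move=> d1; rewrite ler_pdivrMr ?mulr_gt0//.
elim: n => [|n IH]; first by rewrite poch0 fact0; lra.
rewrite pochS factS natrM -natr1.
have p0 : 0 <= poch (1 - d) n by rewrite ltW// poch_gt0//; lra.
have n0 := ler0n R n.
apply: (@le_trans _ _ ((n%:R + 1) * (poch (1 - d) n * (2 * (n%:R + 1))))).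
  by rewrite ler_wpM2l// addr_ge0.
rewrite -mulrA [leLHS]mulrCA ler_wpM2l//.
have : (2^-1 + n%:R) * (2 * (n%:R + 1 + 1)) <= (1 - d + n%:R) * (2 * (n%:R + 1 + 1)).
  by rewrite ler_wpM2r//; lra.
nra.
Qed.

(** Telescoping over the factors: each of the n factors contributes
    (d' - d) n! at most, since the others are bounded by 1, ..., n. *)
Lemma poch_lipschitz d d' n : 0 <= d -> d <= d' -> d' <= 2^-1 ->
  0 <= poch (1 - d) n - poch (1 - d') n <= (d' - d) * (n%:R * n`!%:R).
Proof.
move=> d0 dd d1; apply/andP; split; first by rewrite subr_ge0 poch_le//; lra.
elim: n => [|n IH]; first by rewrite !poch0 subrr mul0r mulr0.
have := poch_fact_le n (le_trans d0 dd) d1.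
rewrite !pochS factS natrM -natr1.
set p := poch _ _ in IH *; set q := poch _ _ in IH *.
set F := n`!%:R in IH * => qF.
have n0 := ler0n R n; have F0 : 0 <= F by exact: ler0n.
have -> : p * (1 - d + n%:R) - q * (1 - d' + n%:R) =
   (p - q) * (1 - d + n%:R) + (d' - d) * q by ring.
apply: (@le_trans _ _ ((d' - d) * (n%:R * F) * (n%:R + 1) + (d' - d) * F)); last first.
  have : 0 <= (d' - d) * F * n%:R by rewrite !mulr_ge0// subr_ge0.
  nra.
rewrite lerD//; last by rewrite ler_wpM2l// subr_ge0.
apply: (@le_trans _ _ ((d' - d) * (n%:R * F) * (1 - d + n%:R))).
  by rewrite ler_wpM2r//; lra.
by rewrite ler_wpM2l ?mulr_ge0 ?subr_ge0//; lra.
Qed.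

(** The Lipschitz constant of S is only a factor O(z) larger than S itself:
    the factor n coming from [poch_lipschitz] undoes one shift of the tail. *)
Lemma high_part_lipschitz : exists2 D : R, 0 <= D & forall z d d', 1 <= z ->
  0 <= d -> d <= d' -> d' <= 2^-1 ->
  0 <= high_part d z - high_part d' z <= (d' - d) * (D * z * T z).
Proof.
have [C C0 H] := high_coef0_le.
have bN : 0 < b + N%:R by rewrite ltr_wpDr.
exists ((1 + C) * (b + N%:R)); first by rewrite mulr_ge0 ?addr_ge0// ltW.
move=> z d d' z1 d0 dd d1; have z0 : 0 < z by exact: lt_le_trans z1.
have den n : 0 < poch b (k.+1 + n) * (k.+1 + n)`!%:R.
  by rewrite mulr_gt0 ?poch_gt0// ltr0n fact_gt0.
have e n : high_coef d n - high_coef d' n =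
    (poch (1 - d) n - poch (1 - d') n) / (poch b (k.+1 + n) * (k.+1 + n)`!%:R).
  by rewrite /high_coef -mulrBl.
rewrite /high_part -psumB; [|exact: entire_high_coef..].
have eB : entire (fun n => high_coef d n - high_coef d' n).
  by apply: entireB; exact: entire_high_coef.
apply/andP; split.
  apply: psum_ge0 => //; first exact: ltW.
  move=> n; rewrite e divr_ge0 ?(ltW (den _))//.
  by have /andP[] := poch_lipschitz n d0 dd d1.
apply: (@le_trans _ _ ((d' - d) * (1 + C) * poch_tail b (k.+1 + k) z)).
  rewrite -psumZ; last exact: entire_poch_tail.
  apply: psum_le; [exact: ltW|exact: eB|by apply: entireZ; exact: entire_poch_tail|].
  move=> n; rewrite e.
  have /andP[_ h] := poch_lipschitz n d0 dd d1.
  apply: (@le_trans _ _ ((d' - d) * (n%:R * high_coef 0 n))).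
    rewrite /high_coef subr0 poch1 !mulrA ler_pM2r ?invr_gt0//.
    by rewrite -!mulrA; apply: le_trans h _; rewrite !mulrA.
  rewrite -mulrA ler_wpM2l ?subr_ge0//.
  apply: (@le_trans _ _ (n%:R * ((1 + C) * (poch b (N + n))^-1))).
    rewrite ler_wpM2l//; apply: (le_trans (H n)); rewrite mulrC ler_wpM2r//.
      by rewrite invr_ge0 ltW// poch_gt0.
    by rewrite lerD2l ler_pdivrMr// ler_peMr// lerDr.
  rewrite mulrCA ler_wpM2l ?addr_ge0// /N addnS addSn pochS invfM mulrCA.
  rewrite -[leRHS]mulr1 ler_wpM2l ?invr_ge0 ?(ltW (poch_gt0 _ b_gt0))//.
  rewrite ler_pdivrMr ?ltr_wpDr// mul1r natrD; have := ler0n R (k.+1 + k); move: b_gt0; lra.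
rewrite -mulrA ler_wpM2l ?subr_ge0// -!mulrA ler_wpM2l ?addr_ge0//.
rewrite poch_tailS// mulrDl -/(T z) -[(k.+1 + k).+1]addnS -/N.
have t0 : (poch b (k.+1 + k))^-1 <= (b + N%:R - 1) * T z.
  have := poch_tail_ge N 0 b_gt0 (ltW z0); rewrite expr0 mul1r addn0 -/(T z) => h.
  apply: (@le_trans _ _ ((b + N%:R - 1) / poch b N)).
    rewrite /N addnS pochS -natr1.
    have -> : b + ((k.+1 + k)%:R + 1) - 1 = b + (k.+1 + k)%:R by ring.
    rewrite invfM mulrCA mulfV ?mulr1//.
    by rewrite gt_eqF// ltr_wpDr.
  rewrite ler_wpM2l// /N addnS -natr1.
  have := ler0n R (k.+1 + k); move: b_gt0; lra.
have T0 := T_gt0 (ltW z0).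
have : (b + N%:R - 1) * T z <= (b + N%:R - 1) * (z * T z).
  rewrite ler_wpM2l//; last by rewrite ler_peMl// ltW.
  rewrite /N addnS -natr1; have := ler0n R (k.+1 + k); move: b_gt0; lra.
rewrite -/(T z); lra.
Qed.

Lemma high_part_ge d z : 0 <= z -> d <= 2^-1 -> poch_tail b N.+1 z / 2 <= high_part d z.
Proof.
move=> z0 d1; rewrite mulrC -psumZ; last exact: entire_poch_tail.
apply: psum_le => //; [by apply: entireZ; exact: entire_poch_tail|exact: entire_high_coef|].
move=> n; apply: (@le_trans _ _ (high_coef 0 n / (2 * (n%:R + 1)))); last first.
  rewrite /high_coef subr0 poch1 mulrAC ler_pM2r; last first.
    by rewrite invr_gt0 mulr_gt0 ?poch_gt0// ltr0n fact_gt0.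
  exact: poch_fact_ge.
rewrite invfM mulrCA ler_wpM2l// ler_pdivlMr//.
apply: le_trans (high_coef0_ge n).
rewrite addSn pochS invfM -mulrA ler_piMr ?invr_ge0 ?(ltW (poch_gt0 _ b_gt0))//.
rewrite mulrC ler_pdivrMr ?ltr_wpDr// mul1r natrD.
have : 1 <= (N%:R : R) by rewrite ler1n.
move: b_gt0; lra.
Qed.

Let f d z := low_part d z - d * (z * high_part d z).

Let f_eq0 d z : 0 < z -> `|d| <= 2^-1 ->
  kummer (a d) b z = 0 <-> low_part d z = d * (z * high_part d z).
Proof.
move=> z0 d2; rewrite kummer_factor//.
have p0 : poch (a d) k * z ^+ k != 0.
  by rewrite mulf_neq0// ?poch_near_neq0// expf_neq0// gt_eqF.
split=> [/eqP|->]; last by rewrite subrr mulr0.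
by rewrite mulf_eq0 (negPf p0)/= subr_eq0 => /eqP.
Qed.

(** A zero satisfies P(d) = d z S(d) with P(d) of order 1.  Hence d > 0, and since
    S(d) is bounded below by a tail of size at least z^2, d = O(z^-3).  On that
    scale the variation of S is negligible, which gives the value of d up to
    1 + O(1/z) and also uniqueness: between two zeros d < d' the increase
    (d' - d) z S would have to be compensated by the variation of P, which is
    O(d' - d).  Existence is the intermediate value theorem on [0, 1/2]. *)
Theorem kummer_zero_near : exists Z C : R, [/\ 1 <= Z, 0 <= C &
  forall z, Z <= z -> exists d, [/\ 0 < d, d <= 2^-1,
    kummer (a d) b z = 0,
    (forall d', `|d'| <= 2^-1 -> kummer (a d') b z = 0 -> d' = d) &
    near_one C z (d * (z * T z) / low_limit)]].
Proof.
have [CP CP0 HP] := low_part_estimate.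
have [Ct Ct0 HT] := high_part0_le.
have [D D0 HD] := high_part_lipschitz.
have P00 := low_limit_gt0.
(* Lower bounds T >= c1 z and T_(N+1) >= c3 z^2 from single terms; M is the
   constant in d <= M z^-3, and E the resulting relative error of S(d). *)
pose c1 := (poch b (N + 1))^-1; pose c3 := (poch b (N.+1 + 2))^-1.
have c10 : 0 < c1 by rewrite invr_gt0 poch_gt0.
have c30 : 0 < c3 by rewrite invr_gt0 poch_gt0.
pose M := 4 * low_limit / c3.
have M0 : 0 <= M by rewrite divr_ge0 ?mulr_ge0 ?(ltW P00) ?(ltW c30).
pose E := Ct + M * D.
have E0 : 0 <= E := addr_ge0 Ct0 (mulr_ge0 M0 D0).
pose Z := 1 + 2 * CP / low_limit + 8 * low_limit / c3 + 2 * E + 2 * (CP / c1 + M * D).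
have t1 : 0 <= 2 * CP / low_limit by rewrite divr_ge0 ?mulr_ge0// ltW.
have t2 : 0 <= 8 * low_limit / c3 by rewrite divr_ge0 ?mulr_ge0// ltW.
have t3 : 0 <= CP / c1 by rewrite divr_ge0// ltW.
have t4 : 0 <= M * D by rewrite mulr_ge0.
exists Z, (CP / low_limit + 2 * E + CP / low_limit * (2 * E)).
have t5 : 0 <= CP / low_limit by rewrite divr_ge0// ltW.
have t6 : 0 <= CP / low_limit * (2 * E) := mulr_ge0 t5 (mulr_ge0 (ler0n _ 2) E0).
split; [by rewrite /Z; lra|by lra|move=> z Zz].
have z1 : 1 <= z by rewrite /Z in Zz; lra.
have z0 : 0 < z by exact: lt_le_trans z1.
have zE : 2 * E <= z by rewrite /Z in Zz; lra.
have T1 : c1 * z <= T z.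
  by have := poch_tail_ge N 1 b_gt0 (ltW z0); rewrite expr1 mulrC.
have T0 : 0 < T z by exact: T_gt0 (ltW z0).
have T3 : c3 * (z * z) <= poch_tail b N.+1 z.
  by have := poch_tail_ge N.+1 2 b_gt0 (ltW z0); rewrite expr2 mulrC.
have low_bounds d : `|d| <= 2^-1 -> low_limit / 2 <= low_part d z <= 2 * low_limit.
  move=> d2; have [h _] := HP z d d z1 d2 d2.
  have : CP / z <= low_limit / 2.
    rewrite ler_pdivrMr// -ler_pdivrMl ?divr_gt0// invf_div mulrAC.
    by rewrite /Z in Zz; lra.
  by move: h; rewrite ler_norml => /andP[]; lra.
have high_lower d : d <= 2^-1 -> c3 * (z * z) / 2 <= high_part d z.
  move=> d2; apply: le_trans (high_part_ge (ltW z0) d2).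
  by rewrite ler_wpM2r.
(* For d <= 0 the right side of the balance is nonpositive. *)
have zero_pos d : `|d| <= 2^-1 -> kummer (a d) b z = 0 -> 0 < d.
  move=> d2 /(f_eq0 z0 d2) e; rewrite ltNge; apply/negP => dle.
  have := low_bounds _ d2 => /andP[h1 _].
  have : 0 <= z * high_part d z.
    apply: mulr_ge0; first exact: ltW.
    apply: le_trans (high_lower d _); last by rewrite (le_trans dle).
    by rewrite !mulr_ge0// ltW.
  nra.
have zero_small d : `|d| <= 2^-1 -> kummer (a d) b z = 0 -> d * (z * z) <= M / z.
  move=> d2 K0; have d0 := zero_pos _ d2 K0.
  have /andP[_ h] := low_bounds _ d2; move/(f_eq0 z0 d2) : K0 => e.
  have dle : d <= 2^-1 by rewrite (le_trans (ler_norm _)).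
  rewrite ler_pdivlMr// /M ler_pdivlMr//.
  have := ler_wpM2l (mulr_ge0 (ltW d0) (ltW z0)) (high_lower d dle).
  rewrite e in h; nra.
have high_close d : `|d| <= 2^-1 -> kummer (a d) b z = 0 ->
    near_one E z (high_part d z / T z).
  move=> d2 K0; have d0 := zero_pos _ d2 K0; have ds := zero_small _ d2 K0.
  have dle : d <= 2^-1 by rewrite (le_trans (ler_norm _)).
  have /andP[h1 h2] := HD z 0 d z1 (lexx _) (ltW d0) dle.
  have h3 := HT z z1; have h4 := high_part0_ge (ltW z0).
  rewrite subr0 in h2.
  have h5 : d * (D * z * T z) <= (M * D / z) * T z.
    have -> : d * (D * z * T z) = (d * z) * (D * T z) by ring.
    have -> : M * D / z * T z = (M / z) * (D * T z) by ring.
    rewrite ler_wpM2r ?mulr_ge0 ?(ltW T0)//.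
    by apply: le_trans ds; rewrite mulrA ler_peMr// mulr_ge0 ?(ltW d0) ?(ltW z0).
  rewrite /near_one.
  have -> : high_part d z / T z - 1 = (high_part d z - T z) / T z by field; rewrite gt_eqF.
  rewrite normrM normfV (gtr0_norm T0) ler_pdivrMr// /E !mulrDl.
  have zi : 0 <= z^-1 by rewrite invr_ge0 ltW.
  have : 0 <= M * D / z * T z := mulr_ge0 (mulr_ge0 t4 zi) (ltW T0).
  have : 0 <= Ct / z * T z := mulr_ge0 (mulr_ge0 Ct0 zi) (ltW T0).
  rewrite mulrDr mulr1 mulrC in h3.
  rewrite ler_norml => u1 u2; apply/andP; split; lra.
(* Subtract the balances at d < d'; dividing by (d' - d) T bounds z. *)
have uniq d d' : `|d| <= 2^-1 -> `|d'| <= 2^-1 -> kummer (a d) b z = 0 ->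
    kummer (a d') b z = 0 -> d < d' -> False.
  move=> d2 d2' K0 K0' dd; have d0 := zero_pos _ d2 K0; have ds := zero_small _ d2 K0.
  have dle : d' <= 2^-1 by rewrite (le_trans (ler_norm _)).
  have /andP[_ h2] := HD z d d' z1 (ltW d0) (ltW dd) dle.
  have [_ h1] := HP z d d' z1 d2 d2'.
  have hc := high_close _ d2' K0'.
  have tld' : T z / 2 <= high_part d' z.
    move: hc; rewrite /near_one ler_norml => /andP[+ _].
    have : E / z <= 2^-1 by rewrite ler_pdivrMr// ler_pdivlMl//.
    move=> u1 u2; have : 2^-1 <= high_part d' z / T z by lra.
    by rewrite ler_pdivlMr// mulrC.
  move/(f_eq0 z0 d2) : K0 => e; move/(f_eq0 z0 d2') : K0' => e'.
  have w0 : 0 < d' - d by rewrite subr_gt0.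
  rewrite distrC ler_norml (distrC d) (gtr0_norm w0) in h1.
  have /andP[_ h3] := h1.
  have h4 : (d' - d) * (z * high_part d' z) <=
      (d' - d) * (CP + M * D / z * T z).
    have -> : (d' - d) * (z * high_part d' z) =
        low_part d' z - low_part d z + d * z * (high_part d z - high_part d' z) by rewrite e e'; ring.
    rewrite [leRHS]mulrDr lerD//; first by rewrite mulrC.
    apply: (@le_trans _ _ (d * z * ((d' - d) * (D * z * T z)))).
      by rewrite ler_wpM2l// mulr_ge0 ?(ltW d0) ?(ltW z0).
    have -> : d * z * ((d' - d) * (D * z * T z)) = (d' - d) * ((d * (z * z)) * (D * T z)) by ring.
    have -> : M * D / z * T z = (M / z) * (D * T z) by ring.
    by rewrite ler_wpM2l ?(ltW w0)// ler_wpM2r// mulr_ge0// ltW.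
  rewrite ler_pM2l// in h4.
  have h5 : M * D / z * T z <= M * D * T z.
    by rewrite ler_wpM2r ?(ltW T0)// ler_pdivrMr// ler_peMr.
  have h6 : CP <= CP / c1 * T z.
    rewrite mulrAC ler_pdivlMr// ler_wpM2l//; apply: le_trans T1.
    by rewrite ler_peMr// ltW.
  have h7 : z * (T z / 2) <= z * high_part d' z by rewrite ler_wpM2l// ltW.
  have h8 : z * (T z / 2) <= (CP / c1 + M * D) * T z by nra.
  have : z / 2 <= CP / c1 + M * D.
    by rewrite -(ler_pM2r T0); apply: le_trans h8; rewrite mulrAC mulrA.
  by rewrite /Z in Zz; lra.
have half : `|2^-1 : R| <= 2^-1 by rewrite ger0_norm.
(* P(0) > 0, while at d = 1/2 the series S dominates. *)
have [d /andP[d0 d2] fd] : exists2 d : R, 0 <= d <= 2^-1 & f d z = 0.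
  apply: (@lipschitz_IVT _ (f ^~ z) 0 2^-1 (CP + z * high_part 0 z + D * z * T z * z)).
  - lra.
  - rewrite !addr_ge0 ?mulr_ge0 ?(ltW T0) ?(ltW z0)//.
    exact: le_trans (ltW T0) (high_part0_ge (ltW z0)).
  - move=> x y x0 xy y2.
    have ax : `|x| <= 2^-1 by rewrite ger0_norm// (le_trans xy).
    have ay : `|y| <= 2^-1 by rewrite ger0_norm// (le_trans x0).
    have [_ h1] := HP z x y z1 ax ay.
    have /andP[h2 h3] := HD z x y z1 x0 xy y2.
    have /andP[h4 h5] := HD z 0 y z1 (lexx _) (le_trans x0 xy) y2.
    have ty : 0 <= high_part y z.
      by rewrite (le_trans _ (high_lower y y2))// !mulr_ge0// ltW.
    have -> : f x z - f y z = (low_part x z - low_part y z) +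
       ((y - x) * (z * high_part y z) - x * z * (high_part x z - high_part y z)) by rewrite /f; ring.
    rewrite (le_trans (ler_normD _ _))// -[_ + D * _ * _ * _]addrA [leRHS]mulrDl lerD//.
      by apply: le_trans h1 _; rewrite distrC ger0_norm ?subr_ge0.
    rewrite (le_trans (ler_normB _ _))// [leRHS]mulrDl lerD//.
      rewrite ger0_norm ?mulr_ge0 ?subr_ge0 ?(ltW z0)// mulrC.
      rewrite ler_wpM2r ?subr_ge0// ler_wpM2l ?(ltW z0)//; lra.
    rewrite ger0_norm ?mulr_ge0 ?(ltW z0)//.
    apply: (@le_trans _ _ (1 * z * ((y - x) * (D * z * T z)))).
      rewrite ler_pM ?mulr_ge0 ?(ltW z0)// ler_wpM2r ?(ltW z0)//; lra.
    by rewrite le_eqVlt; apply/orP; left; apply/eqP; ring.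
  - rewrite /f mul0r subr0; have z2 : `|0 : R| <= 2^-1 by rewrite normr0.
    have /andP[h _] := low_bounds 0 z2; exact: le_trans (divr_ge0 (ltW P00) (ler0n _ 2)) h.
  - rewrite /f; have /andP[_ h] := low_bounds _ half; have h2 := high_lower _ (lexx _).
    have h3 : z * (c3 * (z * z) / 2) <= z * high_part 2^-1 z by rewrite ler_wpM2l// ltW.
    have h4 : 8 * low_limit <= c3 * z.
      by rewrite [leRHS]mulrC -ler_pdivrMr//; rewrite /Z in Zz; lra.
    have h5 : 8 * low_limit <= c3 * z * (z * z).
      by apply: le_trans h4 _; rewrite ler_peMr ?mulr_ge0 ?(ltW z0) ?(ltW c30)// mulr_ege1.
    lra.
have da : `|d| <= 2^-1 by rewrite ger0_norm.
have Kd : kummer (a d) b z = 0.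
  by apply/(f_eq0 z0 da)/eqP; rewrite -subr_eq0 -/(f d z) fd.
exists d; split => //.
- exact: zero_pos.
- move=> d' da' Kd'; case: (ltgtP d' d) => // dd; exfalso.
    exact: uniq dd.
  exact: uniq dd.
have e := (f_eq0 z0 da).1 Kd.
have high_gt0 : 0 < high_part d z by rewrite (lt_le_trans _ (high_lower d d2))// !mulr_gt0.
have -> : d * (z * T z) / low_limit = (low_part d z / low_limit) * (high_part d z / T z)^-1.
  rewrite e; field; rewrite !gt_eqF//.
apply: near_oneM => //; first by rewrite mulr_ge0.
  rewrite /near_one.
  have -> : low_part d z / low_limit - 1 = (low_part d z - low_limit) / low_limit by field; rewrite gt_eqF.
  have [h _] := HP z d d z1 da da.
  rewrite normrM normfV (gtr0_norm P00) (_ : CP / low_limit / z = CP / z / low_limit); last by ring.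
  by rewrite ler_wpM2r// invr_ge0 ltW.
by apply: (near_oneV z0 E0 zE); exact: high_close.
Qed.

End ZerosNearInteger.

(** * The Gamma function and the growth of M(1, c + 1, z) *)

Section GammaAsymptotics.
Context {R : realType}.
Implicit Types (c s t z : R).

Lemma powR_le_expR s : 0 < s -> exists2 C : R, 0 < C &
  forall t, 0 < t -> t `^ s <= C * expR t.
Proof.
move=> s0; exists (expR (s * ln s - s)); first exact: expR_gt0.
move=> t t0; rewrite -expRD /powR gt_eqF// ler_expR.
have := expR_ge1Dx (ln t - ln s).
rewrite expRD expRN !lnK ?posrE// ler_pdivlMr//.
by have := s0; nra.
Qed.

(** The incomplete Gamma function, the integral of s^c exp(-s) over (0, t), in
    terms of its series; see [igamma_is_derive]. *)
Definition igamma c t : R := t `^ c * expR (- t) * (poch_tail (c + 1) 0 t - 1).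

(** K = M(1, c+1, .) satisfies the first order equation t K' = (t - c) K + c,
    because its coefficients satisfy (n + c) k_n = k_(n-1) for n > 0. *)
Lemma poch_tail0_is_derive c t : 0 < c -> exists2 d : R,
  is_derive t 1 (poch_tail (c + 1) 0) d &
  t * d = (t - c) * poch_tail (c + 1) 0 t + c.
Proof.
move=> c0; have c1 : 0 < c + 1 by rewrite addr_gt0.
have et := entire_poch_tail 0 c1.
exists (psum (pseries_diffs (fun n => (poch (c + 1) (0 + n))^-1)) t).
  exact: psum_is_derive.
rewrite psum_mulX//.
have -> : (fun n => n%:R * (poch (c + 1) (0 + n))^-1) =
  (fun n => (n%:R + c) * (poch (c + 1) (0 + n))^-1 + (- c) * (poch (c + 1) (0 + n))^-1).
  by apply/funext => n; ring.
have e2 : entire (fun n => (n%:R + c) * (poch (c + 1) (0 + n))^-1).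
  under eq_fun do rewrite mulrDl.
  by apply: entireD; [exact: entire_mulX|exact: entireZ].
rewrite psumD//; last exact: entireZ.
rewrite psumZ// psumS// add0r poch0 invr1 mulr1 -/(poch_tail _ 0 t).
have -> : (fun n => (n.+1%:R + c) * (poch (c + 1) (0 + n.+1))^-1) =
   (fun n => (poch (c + 1) (0 + n))^-1).
  apply/funext => n; rewrite !add0n pochS invfM -natr1.
  have h : n%:R + 1 + c != 0 :> R by rewrite gt_eqF// ltr_wpDl// ltr_wpDl.
  have h2 : c + 1 + n%:R != 0 :> R by rewrite gt_eqF// ltr_pwDl.
  have h3 : poch (c + 1) n != 0 by rewrite gt_eqF// poch_gt0.
  by field; rewrite h3 h2.
rewrite -/(poch_tail _ 0 t); ring.
Qed.

Lemma igamma_is_derive c t : 0 < c -> 0 < t ->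
  is_derive t 1 (igamma c) (t `^ c * expR (- t)).
Proof.
move=> c0 t0; have [d td te] := poch_tail0_is_derive t c0.
have hp : is_derive t 1 (fun t => t `^ c) (c * t `^ (c - 1)) by exact: is_derive1_powR.
have he : is_derive t 1 (fun t => expR (- t)) (- expR (- t)).
  have := @is_derive1_comp _ expR -%R t _ _ (is_derive_expR (- t)) (is_deriveNid t 1).
  by rewrite mulrN1.
have h1 := @is_deriveM _ _ _ _ t 1 _ _ hp he.
have h2 : is_derive t 1 (fun t => poch_tail (c + 1) 0 t - 1) d.
  by have := is_deriveB td (is_derive_cst (1 : R) t 1); rewrite subr0.
have h3 := is_deriveM h1 h2.
apply: is_derive_eq (h3) _.
rewrite /GRing.scale/=.
have -> : t `^ (c - 1) = t `^ c / t.
  by rewrite powRB ?powRr1 ?ltW// (gt_eqF t0) implybT.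
have -> : d = ((t - c) * poch_tail (c + 1) 0 t + c) / t by rewrite -te mulrAC mulfV ?mul1r// gt_eqF.
rewrite -[((powR (R:=R))^~ c * (fun t => expR (- t))) t]/(t `^ c * expR (- t)).
by field; rewrite gt_eqF.
Qed.

Lemma igamma_gt0 c t : 0 < c -> 0 < t -> 0 < igamma c t.
Proof.
move=> c0 t0; have c1 : 0 < c + 1 by rewrite addr_gt0.
rewrite /igamma !mulr_gt0 ?powR_gt0 ?expR_gt0// poch_tailS// poch0 invr1 addrAC subrr add0r.
by rewrite mulr_gt0// poch_tail_gt0// ltW.
Qed.

(** By t^(c+2) <= C exp(t), the derivative t^c exp(-t) is at most C/t^2, whose
    integral over (t, oo) is C/t. *)
Lemma igamma_increment c : 0 < c -> exists2 C : R, 0 <= C &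
  forall t s, 0 < t -> t <= s -> 0 <= igamma c s - igamma c t <= C / t.
Proof.
move=> c0; have [C C0 H] := @powR_le_expR (c + 2) (addr_gt0 c0 (ltr0n _ 2)).
exists C; first exact: ltW.
move=> t s t0 ts; apply/andP; split.
  rewrite subr_ge0; apply: (derive_ge0_le ts) => x /andP[tx xs].
    by apply: igamma_is_derive => //; exact: lt_le_trans tx.
  by rewrite mulr_ge0 ?powR_ge0 ?expR_ge0.
have hs : 0 <= C * s `^ (-1) by rewrite mulr_ge0 ?powR_ge0// ltW.
suff : igamma c t - C * - t `^ (-1) >= igamma c s - C * - s `^ (-1).
  have e1 : t `^ (-1) = t^-1 by rewrite powR_inv1// ltW.
  by rewrite e1; move: hs; set u := s `^ _; lra.
rewrite -lerN2.
pose g := (fun x => C * - x `^ (-1) - igamma c x).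
suff : g t <= g s by rewrite /g !opprB.
pose df := (fun x => C * - (-1 * x `^ (-1 - 1)) - x `^ c * expR (- x)).
apply: (@derive_ge0_le _ g df _ _ ts) => x /andP[tx xs].
  have x0 : 0 < x by exact: lt_le_trans tx.
  have h1 : is_derive x 1 (fun x => - x `^ (-1)) (- (-1 * x `^ (-1 - 1))).
    exact: is_deriveN (is_derive1_powR (-1) x0).
  have h2 : is_derive x 1 (fun x => C * - x `^ (-1)) (C * - (-1 * x `^ (-1 - 1))).
    exact: is_deriveZ h1.
  exact: is_deriveB h2 (igamma_is_derive c0 x0).
have x0 : 0 < x by exact: lt_le_trans tx.
rewrite /df mulN1r opprK subr_ge0 -(ler_pM2r (expR_gt0 x)) -mulrA -expRD addNr expR0 mulr1.
rewrite -mulrA mulrCA -(ler_pM2l (powR_gt0 2 x0)) mulrCA [leRHS]mulrA mulrA.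
have -> : (-1 - 1 : R) = - 2 by ring.
rewrite -powRD; last by rewrite (gt_eqF x0) implybT.
by rewrite powRN [x `^ 2 * C]mulrC mulfK ?gt_eqF ?powR_gt0// addrC; exact: H.
Qed.

Lemma igamma_cvg c : 0 < c -> igamma c x @[x --> +oo%R] --> Gamma (c + 1).
Proof.
move=> c0; have [C C0 H] := igamma_increment c0.
(* Cut off at 1: [igamma] is monotone on the positive axis only. *)
pose G x := igamma c (Num.max x 1).
have ndG : nondecreasing_fun G.
  move=> x y xy; rewrite -subr_ge0.
  have m1 : 0 < Num.max x 1 by rewrite lt_max ltr01 orbT.
  have mm : Num.max x 1 <= Num.max y 1 by rewrite le_max2.
  by have /andP[] := H _ _ m1 mm.
have ubG : has_ubound (range G).
  exists (igamma c 1 + C) => _ [x _ <-].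
  have m1 : 1 <= Num.max x 1 by rewrite le_max lexx orbT.
  by have /andP[_] := H _ _ ltr01 m1; rewrite divr1 /G; lra.
have cG := nondecreasing_cvgr ndG ubG.
have cF : igamma c x @[x --> +oo%R] --> sup (range G).
  apply: cvg_trans cG; apply: near_eq_cvg; near=> x.
  by rewrite /G max_l//; near: x; exact: nbhs_pinfty_ge.
suff -> : Gamma (c + 1) = sup (range G) by [].
pose f t := t `^ c * expR (- t).
have cf0 : f x @[x --> 0^'+] --> f 0.
  rewrite /f powR0 ?gt_eqF// mul0r -[X in _ --> X](mul0r (expR (- 0 : R))).
  apply: cvgM; first exact: powR_cvg0.
  apply: cvg_at_right_filter; apply: (@continuous_comp _ _ _ -%R expR).
    exact: opp_continuous.
  exact: continuous_expR.
have f0 x : 0 <= f x by rewrite mulr_ge0 ?powR_ge0 ?expR_ge0.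
have cfx (x : R) : 0 < x -> {for x, continuous f}.
  move=> x0; apply: cvgM; first exact: is_derive_continuous (is_derive1_powR c x0).
  apply: (@continuous_comp _ _ _ -%R expR); first exact: opp_continuous.
  exact: continuous_expR.
have cf : {within `[0, +oo[, continuous f}.
  apply/continuous_within_itvcyP; split => // x; rewrite in_itv/= andbT.
  exact: cfx.
have igd (x : R) : 0 < x -> is_derive x 1 (igamma c) (f x) by exact: igamma_is_derive.
have ig0 : igamma c x @[x --> 0^'+] --> igamma c 0.
  rewrite /igamma; apply: cvgM; first exact: cf0.
  apply: cvgB; last exact: cvg_cst.
  apply: cvg_at_right_filter; apply: psum_continuous.
  by apply: entire_poch_tail; rewrite addr_gt0.
have dr (x : R) : 0 < x -> derivable (igamma c) x 1 by move=> /igd[].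
have := Rintegral_ge0_continuous_FTC2y (fun x _ => f0 x) cf cF dr ig0.
rewrite {3}/igamma powR0 ?gt_eqF// !mul0r subr0 => <-; last first.
  by move=> x; rewrite in_itv/= andbT => x0; rewrite derive1E; have [_ ->] := igd x x0.
rewrite /Gamma addrK /Rintegral integral_itv_obnd_cbnd//.
apply/measurable_EFinP; apply: open_continuous_measurable_fun => [//|x].
by rewrite inE/= in_itv/= andbT; exact: cfx.
Unshelve. all: end_near.
Qed.

Lemma Gamma_igamma c : 0 < c -> exists2 C : R, 0 <= C &
  forall z, 0 < z -> 0 <= Gamma (c + 1) - igamma c z <= C / z.
Proof.
move=> c0; have [C C0 H] := igamma_increment c0; exists C => // z z0.
have cF := igamma_cvg c0.
rewrite subr_ge0 lerBlDl; apply/andP; split.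
  apply: (cvgr_to_ge cF); near=> x.
  have zx : z <= x by near: x; apply: nbhs_pinfty_ge; exact: num_real.
  by rewrite -subr_ge0; have /andP[] := H z x z0 zx.
apply: (cvgr_to_le cF); near=> x.
have zx : z <= x by near: x; apply: nbhs_pinfty_ge; exact: num_real.
by rewrite -lerBlDl; have /andP[] := H z x z0 zx.
Unshelve. all: end_near.
Qed.

Lemma Gamma_gt0 c : 0 < c -> 0 < Gamma (c + 1).
Proof.
move=> c0; have [C C0 H] := Gamma_igamma c0.
have := igamma_gt0 c0 ltr01; have /andP[] := H 1 ltr01; lra.
Qed.

(** The integration by parts behind Gamma(s+1) = s Gamma(s), read off the
    series. *)
Lemma igammaS c z : 0 < c -> 0 < z ->
  igamma (c + 1) z = (c + 1) * igamma c z - z `^ (c + 1) * expR (- z).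
Proof.
move=> c0 z0; have c1 : 0 < c + 1 by rewrite addr_gt0.
have c2 : 0 < c + 1 + 1 by rewrite addr_gt0.
rewrite /igamma [poch_tail (c + 1) 0 z]poch_tailS// poch0 invr1.
have -> : poch_tail (c + 1) 1 z = (c + 1)^-1 * poch_tail (c + 1 + 1) 0 z.
  rewrite /poch_tail -psumZ; last exact: entire_poch_tail.
  by congr psum; apply/funext => n; rewrite poch_recl invfM.
have -> : z `^ (c + 1) = z `^ c * z.
  by rewrite powRD ?powRr1 ?(ltW z0)// (gt_eqF z0) implybT.
by field; rewrite gt_eqF.
Qed.

(** Both sides are within O(1/z) of the two sides of [igammaS] at z, for
    every z. *)
Lemma GammaS c : 0 < c -> Gamma (c + 1 + 1) = (c + 1) * Gamma (c + 1).
Proof.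
move=> c0; have c1 : 0 < c + 1 by rewrite addr_gt0.
have [C C0 HC] := Gamma_igamma c0; have [D D0 HD] := Gamma_igamma c1.
have [E E0 HE] := powR_le_expR (addr_gt0 c1 ltr01).
apply/eqP; rewrite -subr_eq0 -normr_le0; apply/ler_addgt0Pl => e e0; rewrite addr0.
pose z := (D + (c + 1) * C + E + 1) / e.
have p1 : 0 <= (c + 1) * C by rewrite mulr_ge0// ltW.
have s0 : 0 < D + (c + 1) * C + E + 1 by lra.
have z0 : 0 < z by rewrite divr_gt0.
have ez : z^-1 * (D + (c + 1) * C + E + 1) = e.
  by rewrite /z invf_div mulfVK// gt_eqF.
clearbody z.
have := HC z z0; have := HD z z0; have := HE z z0.
have -> : z `^ (c + 1 + 1) = z `^ (c + 1) * z.
  by rewrite powRD ?powRr1 ?(ltW z0)// (gt_eqF z0) implybT.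
rewrite igammaS//.
set y := z `^ (c + 1) => h.
have y0 : 0 <= y * expR (- z) by rewrite mulr_ge0 ?powR_ge0 ?expR_ge0.
have h2 : y * expR (- z) <= E / z.
  by rewrite ler_pdivlMr// expRN mulrAC ler_pdivrMr ?expR_gt0.
move=> /andP[h3 h4] /andP[h5 h6].
have h7 := ler_wpM2l (ltW c1) h6; have h8 := ler_wpM2l (ltW c1) h5.
have zi : 0 < z^-1 by rewrite invr_gt0.
(* The bounds are linear once the transcendental terms are variables. *)
rewrite -ez; move: h2 h3 h4 h7 h8 zi y0 D0 p1.
move: (y * expR (- z)) => w; move: (igamma c z) => g.
move: (Gamma (c + 1)) (Gamma (c + 1 + 1)) (z^-1) => G G' t.
move: (c + 1) => b; clear=> *.
by rewrite ler_norml; apply/andP; split; lra.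
Qed.

Lemma Gamma_poch c n : 0 < c ->
  Gamma (c + 1 + n%:R) = poch (c + 1) n * Gamma (c + 1).
Proof.
move=> c0; elim: n => [|n IH]; first by rewrite addr0 poch0 mul1r.
have cn : 0 < c + n%:R by rewrite ltr_pwDl.
rewrite (_ : c + 1 + n.+1%:R = c + n%:R + 1 + 1); last by rewrite -natr1; ring.
rewrite (GammaS cn) (_ : c + n%:R + 1 = c + 1 + n%:R); last by ring.
by rewrite IH pochS; ring.
Qed.

(** The statement M(1, c+1, z) = Gamma(c+1) z^(-c) exp(z) (1 + O(1/z)). *)
Lemma poch_tail0_asymptotics c : 0 < c -> exists2 C : R, 0 <= C & forall z, 1 <= z ->
  near_one C z (poch_tail (c + 1) 0 z * (z `^ c * expR (- z)) / Gamma (c + 1)).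
Proof.
move=> c0; have c1 : 0 < c + 1 by rewrite addr_gt0.
have G0 := Gamma_gt0 c0.
have [C C0 HC] := Gamma_igamma c0; have [E E0 HE] := powR_le_expR c1.
exists ((C + E) / Gamma (c + 1)) => [|z z1].
  by rewrite divr_ge0 ?addr_ge0// ltW.
have z0 : 0 < z by exact: lt_le_trans z1.
have := HC z z0; have := HE z z0; rewrite /near_one /igamma.
have -> : z `^ (c + 1) = z `^ c * z.
  by rewrite powRD ?powRr1 ?(ltW z0)// (gt_eqF z0) implybT.
set y := z `^ c => h.
have y0 : 0 <= y * expR (- z) by rewrite mulr_ge0 ?powR_ge0 ?expR_ge0.
have h2 : y * expR (- z) <= E / z.
  by rewrite ler_pdivlMr// expRN mulrAC ler_pdivrMr ?expR_gt0.
move=> /andP[h3 h4].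
have -> : poch_tail (c + 1) 0 z * (y * expR (- z)) / Gamma (c + 1) - 1 =
  (poch_tail (c + 1) 0 z * (y * expR (- z)) - Gamma (c + 1)) / Gamma (c + 1).
  by field; rewrite gt_eqF.
rewrite normrM normfV (gtr0_norm G0) (_ : (C + E) / _ / z = (C / z + E / z) / Gamma (c + 1)); last by ring.
have zi : 0 < z^-1 by rewrite invr_gt0.
have := divr_ge0 C0 (ltW z0); have := divr_ge0 (ltW E0) (ltW z0).
move=> ? ?; rewrite ler_wpM2r ?invr_ge0 ?(ltW G0)// ler_norml; apply/andP; split; lra.
Qed.

End GammaAsymptotics.

(** * Asymptotics of the zeros *)

Section ZeroAsymptotics.
Context {R : realType}.
Implicit Types (nu z : R) (k : nat).

(** Removing finitely many terms costs a polynomial in z, of lower degree than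
    some single term that is kept. *)
Lemma poch_tail_ratio (b : R) (N : nat) : 0 < b -> exists2 C : R, 0 <= C &
  forall z, 1 <= z -> near_one C z (z ^+ N.+1 * poch_tail b N.+1 z / poch_tail b 0 z).
Proof.
move=> b0; pose S : R := \sum_(i < N.+1) (poch b i)^-1.
have S0 : 0 <= S by apply: sumr_ge0 => i _; rewrite invr_ge0 ltW// poch_gt0.
exists (S * poch b N.+1); first by rewrite mulr_ge0// ltW// poch_gt0.
move=> z z1; have z0 : 0 < z by exact: lt_le_trans z1.
have K0 := poch_tail_gt0 0 b0 (ltW z0).
rewrite /near_one; pose s := \sum_(i < N.+1) (poch b i)^-1 * z ^+ i.
have e : poch_tail b 0 z = s + z ^+ N.+1 * poch_tail b N.+1 z by exact: poch_tail_split.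
have -> : z ^+ N.+1 * poch_tail b N.+1 z / poch_tail b 0 z - 1 = - (s / poch_tail b 0 z).
  have -> : z ^+ N.+1 * poch_tail b N.+1 z = poch_tail b 0 z - s by rewrite e; ring.
  by field; rewrite gt_eqF.
have s0 : 0 <= s.
  by apply: sumr_ge0 => i _; rewrite mulr_ge0 ?exprn_ge0 ?(ltW z0)// invr_ge0 ltW// poch_gt0.
rewrite normrN ger0_norm ?divr_ge0 ?(ltW K0)//.
rewrite ler_pdivrMr//.
have sS : s <= S * z ^+ N.
  rewrite /S mulr_suml; apply: ler_sum => -[i iN] _ /=.
  rewrite ler_wpM2l ?invr_ge0 ?(ltW (poch_gt0 _ b0))//.
  by rewrite ler_weXn2l.
have := poch_tail_ge 0 N.+1 b0 (ltW z0); rewrite add0n => h.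
apply: (le_trans sS); rewrite -!mulrA ler_wpM2l//.
apply: (@le_trans _ _ (poch b N.+1 * (z^-1 * (z ^+ N.+1 / poch b N.+1)))).
  have p0 := poch_gt0 N.+1 b0.
  by rewrite exprS le_eqVlt; apply/orP; left; apply/eqP; field; rewrite !gt_eqF.
by rewrite ler_wpM2l ?(ltW (poch_gt0 _ b0))// ler_wpM2l// invr_ge0 ltW.
Qed.

(** [d] locates the only zero of M(., nu + 1, z) at distance at most 1/2 from
    - k, and equals its asymptotic value up to the relative error C/z. *)
Definition zero_shift nu k z C d : Prop :=
  [/\ 0 < d, d <= 2^-1, kummer (- k%:R - d) (nu + 1) z = 0,
    (forall d' : R, `|d'| <= 2^-1 -> kummer (- k%:R - d') (nu + 1) z = 0 -> d' = d) &
    near_one C z (d / (z `^ (2 * k%:R + 1 + nu) * expR (- z) /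
                     (k`!%:R * Gamma (1 + k%:R + nu))))].

(** The shift d is a product of three ratios, each 1 + O(1/z): the balance of
    [kummer_zero_near], the passage from the tail to M(1, nu+1, z), and the
    growth of M(1, nu+1, z). *)
Theorem kummer_zero_asymptotics nu k : 0 < nu -> exists Z C : R,
  [/\ 1 <= Z, 0 <= C & forall z, Z <= z -> exists d, zero_shift nu k z C d].
Proof.
move=> nu0; have b0 : 0 < nu + 1 by rewrite addr_gt0.
have [Z1 [C1 [Z11 C10 H1]]] := @kummer_zero_near _ (nu + 1) k b0.
have [C2 C20 H2] := poch_tail_ratio (k.+1 + k) b0.
have [C3 C30 H3] := poch_tail0_asymptotics nu0.
have C20' : 0 <= 2 * C2 by rewrite mulr_ge0.
have C30' : 0 <= 2 * C3 by rewrite mulr_ge0.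
pose C4 := 2 * C2 + 2 * C3 + 2 * C2 * (2 * C3).
have C40 : 0 <= C4 by rewrite /C4 !addr_ge0// mulr_ge0.
exists (Z1 + 2 * C2 + 2 * C3), (C1 + C4 + C1 * C4).
split; [lra|by rewrite !addr_ge0// mulr_ge0|move=> z Zz].
have Z1z : Z1 <= z by lra.
have z1 : 1 <= z by lra.
have z0 : 0 < z by exact: lt_le_trans z1.
have [d [d0 d2 Kd du dc]] := H1 z Z1z; exists d; split => //.
have := near_oneV z0 C20 _ (H2 z z1); have := near_oneV z0 C30 _ (H3 z z1).
move=> /(_ ltac:(lra)) h3 /(_ ltac:(lra)) h2.
have := near_oneM z1 C10 C40 dc (near_oneM z1 C20' C30' h2 h3).
congr near_one.
have -> : 1 + k%:R + nu = nu + 1 + k%:R by ring.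
rewrite Gamma_poch// /low_limit.
have G0 := Gamma_gt0 nu0.
have -> : (k.+1 + k.+1)%N = (k.+1 + k).+1 by rewrite addnS.
have -> : z `^ (2 * k%:R + 1 + nu) = z ^+ (k.+1 + k) * z `^ nu.
  rewrite powRD ?(gt_eqF z0) ?implybT//; congr (_ * _).
  by rewrite -powR_mulrn ?(ltW z0)//; congr (_ `^ _); rewrite natrD -natr1; ring.
have T0 := poch_tail_gt0 (k.+1 + k).+1 b0 (ltW z0).
have K0 := poch_tail_gt0 0 b0 (ltW z0).
have p0 := poch_gt0 k b0.
have f0 : (k`!%:R : R) != 0 by rewrite pnatr_eq0 -lt0n fact_gt0.
have y0 := powR_gt0 nu z0; have e0 := expR_gt0 (- z).
have zn : 0 < z ^+ (k.+1 + k) by rewrite exprn_gt0.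
rewrite exprS; move: T0 K0 y0 e0 zn p0 G0.
move: (poch_tail _ _.+1 z) (poch_tail _ 0 z) (z `^ nu) (expR _) (z ^+ _) (poch _ _) (Gamma _) => T K y e zn p G.
move=> T0 K0 y0 e0 zn0 p0 G0.
by field; rewrite f0 !gt_eqF.
Qed.

End ZeroAsymptotics.

(** * The regular solution of the differential equation *)

Section Phi.
Context {R : realType}.
Variables (nu h : R).
Hypotheses (nu_gt0 : 0 < nu) (h_gt0 : 0 < h).
Implicit Types (e x y z : R) (u v : R -> R).

Definition potential x : R := h ^+ 2 * (nu ^+ 2 - 4^-1) * x ^- 2 + x ^+ 2.
(** The first parameter of Kummer's function that belongs to the energy [e]. *)
Definition kummer_param e : R := (nu + 1) / 2 - e / (4 * h).

Definition prefactor x : R := x `^ (nu + 2^-1) * expR (- x ^+ 2 / (2 * h)).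
Definition phi e x : R :=
  prefactor x * kummer (kummer_param e) (nu + 1) (x ^+ 2 / h).
Definition phi1 e x : R :=
  ((nu + 2^-1) / x - x / h) * phi e x +
  prefactor x * (2 * x / h * kummer1 (kummer_param e) (nu + 1) (x ^+ 2 / h)).

Let nu1_gt0 : 0 < nu + 1. Proof. by rewrite addr_gt0. Qed.

Lemma sqr_is_derive (c x : R) : is_derive x 1 (fun x => x ^+ 2 / c) (2 * x / c).
Proof.
have h1 := @is_deriveX _ _ _ 2 x 1 1 (is_derive_id x (1 : R)).
have h2 := is_deriveZ c^-1 h1.
have -> : (fun x => x ^+ 2 / c) = c^-1 *: (id ^+ 2 : R -> R).
  by apply/funext => y; rewrite /GRing.scale/= /GRing.scale/= mulrC.
apply: is_derive_eq.
by rewrite /GRing.scale/= expr1 mulr1; ring.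
Qed.

Lemma prefactor_is_derive x : 0 < x ->
  is_derive x 1 prefactor (((nu + 2^-1) / x - x / h) * prefactor x).
Proof.
move=> x0.
have h1 : is_derive x 1 (fun x => x `^ (nu + 2^-1)) _ := is_derive1_powR _ x0.
have h2 : is_derive x 1 (fun x => expR (- x ^+ 2 / (2 * h)))
    (expR (- x ^+ 2 / (2 * h)) * - (2 * x / (2 * h))).
  apply: (@is_derive1_comp _ expR (fun x => - x ^+ 2 / (2 * h)) x).
  have -> : (fun x => - x ^+ 2 / (2 * h)) = - (fun x => x ^+ 2 / (2 * h)).
    by apply/funext => y; rewrite mulNr.
  exact: is_deriveN (sqr_is_derive _ _).
have h3 := is_deriveM h1 h2.
apply: is_derive_eq h3 _; rewrite /GRing.scale/= /prefactor.
have -> : x `^ (nu + 2^-1 - 1) = x `^ (nu + 2^-1) / x.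
  by rewrite powRB ?powRr1 ?ltW// (gt_eqF x0) implybT.
by field; rewrite !gt_eqF.
Qed.

Lemma kummer_comp_is_derive a x : is_derive x 1
  (fun x => kummer a (nu + 1) (x ^+ 2 / h))
  (2 * x / h * kummer1 a (nu + 1) (x ^+ 2 / h)).
Proof.
rewrite mulrC; apply: (@is_derive1_comp _ (kummer a (nu + 1)) (fun x => x ^+ 2 / h)).
  exact: kummer_is_derive.
exact: sqr_is_derive.
Qed.

Lemma kummer1_comp_is_derive a x : is_derive x 1
  (fun x => kummer1 a (nu + 1) (x ^+ 2 / h))
  (2 * x / h * kummer2 a (nu + 1) (x ^+ 2 / h)).
Proof.
rewrite mulrC; apply: (@is_derive1_comp _ (kummer1 a (nu + 1)) (fun x => x ^+ 2 / h)).
  exact: kummer1_is_derive.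
exact: sqr_is_derive.
Qed.

Lemma phi_is_derive e x : 0 < x -> is_derive x 1 (phi e) (phi1 e x).
Proof.
move=> x0; have h1 := prefactor_is_derive x0.
have h2 := kummer_comp_is_derive (kummer_param e) x.
apply: is_derive_eq (is_deriveM h1 h2) _.
by rewrite /GRing.scale/= /phi1 /phi; ring.
Qed.

(** Substituting z = x^2/h, the terms in M' cancel exactly because the second
    parameter is nu + 1, and Kummer's equation removes M''. *)
Lemma phi1_is_derive e x : 0 < x ->
  is_derive x 1 (phi1 e) ((potential x - e) / h ^+ 2 * phi e x).
Proof.
move=> x0; have hp := prefactor_is_derive x0.
set a := kummer_param e.
have h1 := kummer1_comp_is_derive a x.
have hf := phi_is_derive e x0.
have hl : is_derive x 1 (fun x => (nu + 2^-1) / x - x / h)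
    (- (nu + 2^-1) / x ^+ 2 - h^-1).
  have x0' : x != 0 by rewrite gt_eqF.
  have i1 : is_derive x 1 (fun x => x^-1) (- x ^- 2).
    have := @is_deriveV _ id x 1 1 x0' (is_derive_id x (1 : R)).
    by move=> /is_derive_eq; apply; rewrite /GRing.scale/= mulr1.
  have i2 := is_deriveB (is_deriveZ (nu + 2^-1) i1) (is_deriveZ h^-1 (is_derive_id x (1 : R))).
  have -> : (fun x => (nu + 2^-1) / x - x / h) =
     ((nu + 2^-1) *: (fun x => x^-1) - h^-1 *: id).
    by apply/funext => y; rewrite /GRing.scale/= [_ / h]mulrC.
  by apply: is_derive_eq i2 _; rewrite /GRing.scale/= mulr1; ring.
have hx : is_derive x 1 (fun x => 2 * x / h) (2 / h).
  have -> : (fun x => 2 * x / h) = (2 / h) *: id.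
    by apply/funext => y; rewrite /GRing.scale/= /GRing.scale/=; ring.
  by apply: is_derive_eq (is_deriveZ _ (is_derive_id x (1 : R))) _; rewrite /GRing.scale/= mulr1.
have h3 := is_deriveD (is_deriveM hl hf) (is_deriveM hp (is_deriveM hx h1)).
apply: is_derive_eq h3 _; rewrite /GRing.scale/=.
rewrite -[((fun x => 2 * x / h) * _) x]/(2 * x / h * kummer1 a (nu + 1) (x ^+ 2 / h)).
rewrite /phi1 -/a /phi -/a.
have := kummer_ode a (x ^+ 2 / h) nu1_gt0.
set M := kummer a _ _; set M1 := kummer1 a _ _; set M2 := kummer2 a _ _; set P := prefactor x => ode.
have ode2 : M2 = (a * M - (nu + 1 - x ^+ 2 / h) * M1) * (h / x ^+ 2).
  by rewrite -ode; field; rewrite !gt_eqF.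
rewrite ode2 /potential /a /kummer_param.
by field; rewrite !gt_eqF.
Qed.

Lemma phi_bounds e : exists2 r : R, 0 < r & forall x, 0 < x -> x < r ->
  x `^ (nu + 2^-1) / 2 <= phi e x <= 2 * x `^ (nu + 2^-1).
Proof.
pose g x := expR (- x ^+ 2 / (2 * h)) * kummer (kummer_param e) (nu + 1) (x ^+ 2 / h).
have g0 : g 0 = 1 by rewrite /g expr0n/= oppr0 !mul0r expR0 kummer0// mulr1.
have cg : {for 0, continuous g}.
  apply: cvgM.
    apply: (@continuous_comp _ _ _ (fun x => - x ^+ 2 / (2 * h)) expR); last exact: continuous_expR.
    have -> : (fun x => - x ^+ 2 / (2 * h)) = - (fun x => x ^+ 2 / (2 * h)).
      by apply/funext => y; rewrite mulNr.
    exact: is_derive_continuous (is_deriveN (sqr_is_derive _ _)).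
  exact: is_derive_continuous (kummer_comp_is_derive _ _).
have : \forall x \near (0 : R), `|g 0 - g x| < 2^-1.
  by apply: cvgr_dist_lt cg _ _; rewrite invr_gt0.
rewrite g0 => /nbhs_ballP[r /= r0 H]; exists r => // x x0 xr.
have := H x; rewrite /ball/= sub0r normrN gtr0_norm// => /(_ xr).
rewrite ltr_norml => /andP[h1 h2].
have -> : phi e x = x `^ (nu + 2^-1) * g x by rewrite /phi /prefactor -mulrA.
have p0 := powR_gt0 (nu + 2^-1) x0.
by rewrite [2 * _]mulrC !ler_pM2l//; apply/andP; split; lra.
Qed.

Definition ode_sol (I : set R) (V u u1 : R -> R) := forall x, I x ->
  is_derive x 1 u (u1 x) /\ is_derive x 1 u1 (V x * u x).

Lemma ode_sol_lin I V c u u1 v v1 : ode_sol I V u u1 -> ode_sol I V v v1 ->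
  ode_sol I V (fun x => u x - c * v x) (fun x => u1 x - c * v1 x).
Proof.
move=> su sv x Ix; have [hu hu1] := su x Ix; have [hv hv1] := sv x Ix; split.
  exact: is_deriveB hu (is_deriveZ c hv).
by apply: is_derive_eq (is_deriveB hu1 (is_deriveZ c hv1)) _; rewrite /GRing.scale/=; ring.
Qed.

Lemma phi_sol e I : I `<=` `]0, +oo[ ->
  ode_sol I (fun x => (potential x - e) / h ^+ 2) (phi e) (phi1 e).
Proof.
move=> I0 x /I0; rewrite /= in_itv/= andbT => x0.
by split; [exact: phi_is_derive|exact: phi1_is_derive].
Qed.

(** The equation has no first order term. *)
Lemma wronskian_const I V u u1 v v1 x y : is_interval I ->
  ode_sol I V u u1 -> ode_sol I V v v1 -> I x -> I y ->
  u x * v1 x - u1 x * v x = u y * v1 y - u1 y * v y.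
Proof.
move=> cI su sv Ix Iy.
wlog xy : x y Ix Iy / x <= y.
  by move=> H; have [/H|/ltW/H ->//] := leP x y; exact.
apply: (@derive_eq0_eq _ (fun t => u t * v1 t - u1 t * v t) _ _ xy) => t txy.
have It := cI x y Ix Iy t txy.
have [hu hu1] := su t It; have [hv hv1] := sv t It.
apply: is_derive_eq (is_deriveB (is_deriveM hu hv1) (is_deriveM hu1 hv)) _.
by rewrite /GRing.scale/=; ring.
Qed.

(** The energy E = u^2 + u'^2 satisfies |E'| <= (1 + K) E, so
    E(t) exp(-(1+K) t) cannot increase from its initial value 0. *)
Lemma ode_zero_forward V u u1 K x y : 0 <= K -> x <= y ->
  (forall t, x <= t <= y -> `|V t| <= K) ->
  ode_sol `[x, y] V u u1 -> u x = 0 -> u1 x = 0 -> u y = 0.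
Proof.
move=> K0 xy VK su ux u1x.
pose E t := u t ^+ 2 + u1 t ^+ 2.
suff : E y <= 0.
  move=> Ey; apply/eqP; rewrite -sqrf_eq0; apply/eqP/le_anti.
  have := sqr_ge0 (u y); have := sqr_ge0 (u1 y); rewrite /E in Ey => ? ?.
  by apply/andP; split; lra.
pose G t := - (E t * expR (- (1 + K) * t)).
pose dG t := - ((2 * u t * u1 t + 2 * u1 t * (V t * u t)) * expR (- (1 + K) * t)
               + E t * (expR (- (1 + K) * t) * - (1 + K))).
suff : G x <= G y.
  rewrite /G {1}/E ux u1x expr0n/= addr0 mul0r oppr0 oppr_ge0.
  by rewrite pmulr_lle0// expR_gt0.
apply: (@derive_ge0_le _ G dG _ _ xy) => t txy.
  have [hu hu1] := su t txy.
  have he : is_derive t 1 (fun t => expR (- (1 + K) * t)) (expR (- (1 + K) * t) * - (1 + K)).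
    apply: (@is_derive1_comp _ expR (fun t => - (1 + K) * t) t).
    by apply: is_derive_eq (is_deriveZ (- (1 + K)) (is_derive_id t (1 : R))) _; rewrite /GRing.scale/= mulr1.
  have hE : is_derive t 1 E (2 * u t * u1 t + 2 * u1 t * (V t * u t)).
    have -> : E = u * u + u1 * u1 by apply/funext => s; rewrite /E !expr2.
    apply: is_derive_eq (is_deriveD (is_deriveM hu hu) (is_deriveM hu1 hu1)) _.
    by rewrite /GRing.scale/=; ring.
  apply: is_derive_eq (is_deriveN (is_deriveM hE he)) _.
  by rewrite /GRing.scale/= /dG; ring.
rewrite /dG [X in - X](_ : _ = expR (- (1 + K) * t) *
  (2 * u t * u1 t * (1 + V t) - (1 + K) * E t)); last by ring.
rewrite oppr_ge0 pmulr_rle0 ?expR_gt0// subr_le0.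
apply: le_trans (ler_norm _) _; rewrite normrM mulrC.
rewrite ler_pM//.
  by rewrite (le_trans (ler_normD _ _))// normr1 lerD2l VK.
rewrite /E ler_norml; have := sqr_ge0 (u t + u1 t); have := sqr_ge0 (u t - u1 t).
by rewrite !expr2 => ? ?; apply/andP; split; nra.
Qed.

(** The derivative of u / phi is - w / phi^2 <= - w / (4 x^(2nu+1)), which is
    the derivative of k0 x^(-2nu) with k0 = w / (8 nu).  So
    u / phi - k0 x^(-2nu) is nonincreasing, hence bounded below near 0, and
    multiplying by phi >= x^(nu+1/2) / 2 gives the bound. *)
Lemma singular_lower_bound e I u u1 (r w : R) : I `<=` `]0, +oo[ -> 0 < r ->
  `]0, r[ `<=` I -> ode_sol I (fun x => (potential x - e) / h ^+ 2) u u1 ->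
  0 < w -> (forall x, I x -> u x * phi1 e x - u1 x * phi e x = w) ->
  exists k r' : R, [/\ 0 < k, 0 < r' &
    forall x, 0 < x -> x < r' -> k * x `^ (2^-1 - nu) <= u x].
Proof.
move=> I0 r0 rI su w0 W; have [rf rf0 Hf] := phi_bounds e.
pose k0 := w / (8 * nu).
have k00 : 0 < k0 by rewrite divr_gt0// mulr_gt0.
pose q x := u x / phi e x - k0 * x `^ (- (2 * nu)).
pose y0 := Num.min (r / 2) (rf / 2).
have y00 : 0 < y0 by rewrite lt_min !divr_gt0.
have y0r : y0 < r by rewrite gt_min; apply/orP; left; lra.
have y0f : y0 < rf by rewrite gt_min; apply/orP; right; lra.
have mono (x : R) : 0 < x -> x <= y0 -> q y0 <= q x.
  move=> x0 xy; rewrite -lerN2.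
  pose dq t := - ((- w) / phi e t ^+ 2 + (2 * nu * k0) * t `^ (- (2 * nu) - 1)).
  apply: (@derive_ge0_le _ (fun t => - q t) dq _ _ xy) => t /andP[xt ty];
    have t0 : 0 < t by [exact: lt_le_trans xt];
    have tr : t < r by [exact: le_lt_trans y0r];
    have tf : t < rf by [exact: le_lt_trans y0f];
    have /andP[f1 f2] := Hf t t0 tf;
    have p0 := powR_gt0 (nu + 2^-1) t0;
    have f0 : 0 < phi e t by [apply: lt_le_trans f1; rewrite divr_gt0];
    have It : I t by [apply: rI; rewrite /= in_itv/= t0 tr].
    have [hu hu1] := su t It.
    have hp := phi_is_derive e t0.
    have hV : is_derive t 1 (fun x => (phi e x)^-1) (- (phi e t) ^- 2 * phi1 e t).
      have f0' : phi e t != 0 by rewrite gt_eqF.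
      exact: (is_derive_eq (is_deriveV f0' hp)).
    have hP := is_derive1_powR (- (2 * nu)) t0.
    have := is_deriveN (is_deriveB (is_deriveM hu hV) (is_deriveZ k0 hP)).
    move=> /is_derive_eq; apply; rewrite /GRing.scale/= /dq.
    by rewrite -(W t It); field; rewrite gt_eqF.
  rewrite /dq oppr_ge0 mulNr addrC subr_le0.
  have -> : 2 * nu * k0 = w / 4 by rewrite /k0; field; rewrite gt_eqF.
  rewrite -mulrA ler_wpM2l ?(ltW w0)//.
  have -> : - (2 * nu) - 1 = - ((nu + 2^-1) * 2) by field.
  rewrite powRN -invfM lef_pV2 ?posrE ?exprn_gt0// ?mulr_gt0 ?powR_gt0//.
  rewrite powRrM -[_ `^ 2]/(_ `^ 2%:R) powR_mulrn ?powR_ge0//.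
  have -> : 4 = 2 ^+ 2 :> R by rewrite expr2; ring.
  by rewrite -exprMn lerXn2r// nnegrE ltW// mulr_gt0.
pose A := `|q y0| + 1.
have A0 : 0 < A by rewrite ltr_wpDl.
have : \forall x \near 0^'+, x `^ (2 * nu) < k0 / (2 * A).
  have c2 : 0 < 2 * nu by rewrite mulr_gt0.
  have /cvgrPdist_lt := @powR_cvg0 R _ c2.
  move=> /(_ (k0 / (2 * A))).
  have kA : 0 < k0 / (2 * A) := divr_gt0 k00 (mulr_gt0 (ltr0n _ 2) A0).
  move=> /(_ kA).
  by apply: filterS => x; rewrite sub0r normrN ger0_norm ?powR_ge0.
move=> [d /= d0 Hd]; exists (k0 / 4), (Num.min d y0); split; [by rewrite divr_gt0|by rewrite lt_min d0|].
move=> x x0; rewrite lt_min => /andP[xd xy].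
have small : x `^ (2 * nu) < k0 / (2 * A).
  by apply: Hd => //=; rewrite /ball/= sub0r normrN gtr0_norm.
have pn := powR_gt0 (2 * nu) x0.
have big : A <= k0 / 2 * x `^ (- (2 * nu)).
  rewrite powRN ler_pdivlMr// ler_pdivlMr//.
  move: small; rewrite ltr_pdivlMr ?mulr_gt0//; lra.
have := mono x x0 (ltW xy); rewrite /q => hq.
have q1 : - A <= q y0 by rewrite /A; have := ler_norm (- q y0); rewrite normrN; lra.
have h1 : k0 / 2 * x `^ (- (2 * nu)) <= u x / phi e x by rewrite /q in q1; lra.
have /andP[f1 f2] := Hf x x0 (lt_trans xy y0f).
have p0 := powR_gt0 (nu + 2^-1) x0.
have f0 : 0 < phi e x by apply: lt_le_trans f1; rewrite divr_gt0.
rewrite ler_pdivlMr// in h1; apply: le_trans h1.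
have -> : 2^-1 - nu = - (2 * nu) + (nu + 2^-1) by ring.
rewrite powRD ?(gt_eqF x0) ?implybT//.
have := powR_gt0 (- (2 * nu)) x0; set X := x `^ _ => X0.
have -> : k0 / 4 * (X * x `^ (nu + 2^-1)) = k0 / 2 * X * (x `^ (nu + 2^-1) / 2) by field.
by apply: ler_wpM2l f1; rewrite ltW// mulr_gt0// divr_gt0.
Qed.

(** The excluded lower bound forces the Wronskian with [phi e] to vanish.  Then
    u / phi is constant as long as phi > 0, which holds near 0, and uniqueness
    for the initial value problem carries the proportionality to all of I. *)
Lemma regular_solution e I u u1 : is_interval I -> I `<=` `]0, +oo[ ->
  (exists2 r, 0 < r & `]0, r[ `<=` I) ->
  ode_sol I (fun x => (potential x - e) / h ^+ 2) u u1 ->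
  (forall k r : R, 0 < k -> 0 < r ->
     ~ (forall x, 0 < x -> x < r -> k * x `^ (2^-1 - nu) <= `|u x|)) ->
  exists c, forall x, I x -> u x = c * phi e x.
Proof.
move=> cI I0 [r r0 rI] su nsing; have sphi := phi_sol e I0.
have [rf rf0 Hf] := phi_bounds e.
pose x0 := Num.min (r / 2) (rf / 2).
have x00 : 0 < x0 by rewrite lt_min !divr_gt0.
have x0r : x0 < r by rewrite gt_min; apply/orP; left; lra.
have x0f : x0 < rf by rewrite gt_min; apply/orP; right; lra.
have Ismall x : 0 < x -> x <= x0 -> I x.
  by move=> xp xx; apply: rI; rewrite /= in_itv/= xp (le_lt_trans xx).
have fpos x : 0 < x -> x <= x0 -> 0 < phi e x.
  move=> xp xx; have /andP[f1 _] := Hf x xp (le_lt_trans xx x0f).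
  by apply: lt_le_trans f1; rewrite divr_gt0// powR_gt0.
have Ix0 : I x0 by exact: Ismall.
pose w := u x0 * phi1 e x0 - u1 x0 * phi e x0.
have W x : I x -> u x * phi1 e x - u1 x * phi e x = w.
  by move=> Ix; exact: wronskian_const cI su sphi Ix Ix0.
have w0 : w = 0.
  case: (ltgtP w 0) => // wl; exfalso.
    have su' := ode_sol_lin 1 (ode_sol_lin 1 su su) su.
    have W' x : I x -> (u x - 1 * u x - 1 * u x) * phi1 e x -
        (u1 x - 1 * u1 x - 1 * u1 x) * phi e x = - w.
      by move=> /W <-; ring.
    have wn : 0 < - w by rewrite oppr_gt0.
    have [k [r' [k0 r0' H]]] := singular_lower_bound I0 r0 rI su' wn W'.
    apply: (nsing _ _ k0 r0') => x xp xr; apply: le_trans (H x xp xr) _.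
    by rewrite !mul1r subrr sub0r -normrN ler_norm.
  have [k [r' [k0 r0' H]]] := singular_lower_bound I0 r0 rI su wl W.
  apply: (nsing _ _ k0 r0') => x xp xr; apply: le_trans (H x xp xr) _.
  exact: ler_norm.
exists (u x0 / phi e x0) => x Ix; set c := _ / _.
have fx0 := fpos _ x00 (lexx _).
have xp : 0 < x by have := I0 x Ix; rewrite /= in_itv/= andbT.
have [xx|/ltW xx] := leP x x0.
  have : u x / phi e x = u x0 / phi e x0.
    apply: (@derive_eq0_eq _ (fun t => u t / phi e t) _ _ xx) => t /andP[xt tx].
    have tp : 0 < t by exact: lt_le_trans xt.
    have It := Ismall t tp tx; have ft := fpos t tp tx.
    have [hu hu1] := su t It.
    have hV : is_derive t 1 (fun x => (phi e x)^-1) (- (phi e t) ^- 2 * phi1 e t).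
      have f0' : phi e t != 0 by rewrite gt_eqF.
      exact: (is_derive_eq (is_deriveV f0' (phi_is_derive e tp))).
    apply: is_derive_eq (is_deriveM hu hV) _.
    rewrite /GRing.scale/=.
    have -> : u t * (- (phi e t) ^- 2 * phi1 e t) + (phi e t)^-1 * u1 t =
      - (u t * phi1 e t - u1 t * phi e t) / phi e t ^+ 2 by field; rewrite gt_eqF.
    by rewrite W// w0 oppr0 mul0r.
  by rewrite /c => <-; rewrite divfK// gt_eqF// fpos.
have sw := ode_sol_lin c su sphi.
apply/eqP; rewrite -subr_eq0; apply/eqP.
pose K := (h ^+ 2 * `|nu ^+ 2 - 4^-1| * x0 ^- 2 + x ^+ 2 + `|e|) / h ^+ 2.
apply: (@ode_zero_forward _ _ _ K x0 x _ xx _ (fun t tx => sw t (cI x0 x Ix0 Ix t tx))).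
- rewrite /K divr_ge0 ?sqr_ge0// !addr_ge0 ?sqr_ge0//.
  apply: mulr_ge0; last by rewrite invr_ge0 sqr_ge0.
  by apply: mulr_ge0; [exact: sqr_ge0|exact: normr_ge0].
- move=> t /andP[xt tx]; have t0 : 0 < t by exact: lt_le_trans xt.
  rewrite /K normrM normfV (ger0_norm (sqr_ge0 h)) ler_wpM2r ?invr_ge0 ?sqr_ge0//.
  rewrite (le_trans (ler_normB _ _))// lerD2r /potential (le_trans (ler_normD _ _))// lerD//.
    rewrite 2!normrM (ger0_norm (sqr_ge0 h)) normfV (ger0_norm (sqr_ge0 t)).
    apply: ler_wpM2l; first exact: mulr_ge0 (sqr_ge0 h) (normr_ge0 _).
    by rewrite lef_pV2 ?posrE ?exprn_gt0// lerXn2r// nnegrE ltW.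
  by rewrite ger0_norm ?sqr_ge0// lerXn2r// nnegrE ltW.
- by rewrite /c divfK ?subrr// gt_eqF.
have := W _ Ix0; rewrite w0 => /eqP; rewrite subr_eq0 => /eqP e1.
rewrite /c; have -> : u x0 / phi e x0 * phi1 e x0 = (u x0 * phi1 e x0) / phi e x0 by ring.
by rewrite e1 mulfK ?subrr// gt_eqF.
Qed.

End Phi.

(** * Absolutely continuous functions with continuous derivative *)

Section AbsolutelyContinuous.
Context {R : realType}.
Local Notation mu := (@lebesgue_measure R).
Implicit Types (I : set R) (f g k : R -> R).

Lemma locally_integrable_itv I g a b : locally_integrable I g ->
  `[a, b] `<=` I -> mu.-integrable `[a, b] (EFin \o g).
Proof.
move=> [mg oI iI] abI; apply/integrableP; split.
  apply/measurable_EFinP; apply: measurable_funS mg => //.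
  exact: open_measurable.
by have := iI _ abI (@segment_compact R a b).
Qed.

(** Localizes an indefinite integral to a compact interval around [x], where the
    integrand is integrable and the fundamental theorem applies. *)
Lemma AC_deriv_near I f g x : AC_deriv I f g -> I x ->
  exists a b, [/\ a < x, x < b, `[a, b] `<=` I &
   {near x, (fun y => f a + \int[mu]_(t in `[a, y]) g t) =1 f}].
Proof.
move=> [[mg oI iI] fg] Ix.
have [r /= r0 H] := open_itvcc_subset oI Ix.
pose s := r / 2; have s0 : 0 < s by rewrite divr_gt0.
have sI : `[x - s, x + s] `<=` I.
  apply: H => //=; rewrite sub0r normrN gtr0_norm//.
  by rewrite /s ltr_pdivrMr// ltr_pMr// ltr1n.
exists (x - s), (x + s); split => //; [by rewrite ltrBlDr ltrDl|by rewrite ltrDl|].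
near=> y; have xy : x - s <= y <= x + s.
  have : `|x - y| < s.
    by near: y; apply: (@cvgr_dist_lt _ _ _ (nbhs x) _ id x); first exact: cvg_id.
  by rewrite ltr_norml => /andP[]; lra.
have Iy : I y by apply: sI; rewrite /= in_itv/=.
have Ia : I (x - s) by apply: sI; rewrite /= in_itv/= lexx; lra.
have /andP[ay _] := xy.
by rewrite -(fg _ _ Ia Iy ay) addrC subrK.
Unshelve. all: end_near. Qed.

Lemma AC_deriv_continuous I f g x : AC_deriv I f g -> I x ->
  {for x, continuous f}.
Proof.
move=> fg Ix; have [a [b [ax xb abI nf]]] := AC_deriv_near fg Ix.
have ab : a < b by exact: lt_trans xb.
have iab := locally_integrable_itv fg.1 abI.
have xab : x \in `]a, b[ by rewrite in_itv/= ax xb.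
have cF := within_continuous_continuous ab
  (parameterized_integral_continuous (ltW ab) iab) xab.
have cG : {for x, continuous (fun y => f a + \int[mu]_(t in `[a, y]) g t)}.
  by apply: cvgD; [exact: cvg_cst|exact: cF].
change (f y @[y --> x] --> f x).
rewrite -(nbhs_singleton nf).
by apply: cvg_trans cG; apply: near_eq_cvg; apply: filterS nf => y ->.
Qed.

(** The regularity bootstrap: the weak derivative may be replaced by any
    continuous function to which it is almost everywhere equal. *)
Lemma AC_deriv_is_derive I f g k x : AC_deriv I f g ->
  {ae mu, forall y, I y -> g y = k y} ->
  (forall y, I y -> {for y, continuous k}) -> I x -> is_derive x 1 f (k x).
Proof.
move=> fg gk ck Ix; have [a [b [ax xb abI nf]]] := AC_deriv_near fg Ix.
have [_ oI _] := fg.1.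
have kab : mu.-integrable `[a, b] (EFin \o k).
  apply: continuous_compact_integrable; first exact: segment_compact.
  by apply: continuous_in_subspaceT => y; rewrite inE => /abI; exact: ck.
have mk : measurable_fun I k.
  by apply: open_continuous_measurable_fun => // y; rewrite inE; exact: ck.
have [dF dFk] := @continuous_FTC1_closed R k a x b xb kab ax (ck _ Ix).
have nk : {near x, (fun y => f a + \int[mu]_(t in `[a, y]) k t) =1 f}.
  have xbn : \forall y \near x, y <= b.
    by apply: filterS (lt_nbhsl xb) => y; exact: ltW.
  apply: filterS2 nf xbn => y fy yb; rewrite -fy; congr (_ + _).
  have ayI : `[a, y] `<=` I.
    move=> t /=; rewrite in_itv/= => /andP[at_ ty]; apply: abI.
    by rewrite /= in_itv/= at_ (le_trans ty).
  rewrite /Rintegral; congr fine; apply: ae_eq_integral => //.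
  - by apply/measurable_EFinP; apply: measurable_funS mk => //; exact: open_measurable.
  - by have [mg _ _] := fg.1; apply/measurable_EFinP; apply: measurable_funS mg => //; exact: open_measurable.
  by apply: (@filterS _ _ (ae_filter_ringOfSetsType mu) _ _ _ gk) => t gt /ayI/gt ->.
have dG : is_derive x 1 (fun y => f a + \int[mu]_(t in `[a, y]) k t) (k x).
  have h1 : is_derive x 1 (fun y => \int[mu]_(t in `[a, y]) k t) (k x).
    by split; rewrite -?derive1E.
  by apply: is_derive_eq (is_deriveD (is_derive_cst (f a) x 1) h1) _; rewrite add0r.
case: dG => dG1 dG2; split.
  exact: near_eq_derivable nk dG1.
by rewrite -dG2; apply: near_eq_derive => //; apply: filterS nk => y ->.
Qed.

Lemma AC_deriv_of_derive I f g : open I -> is_interval I ->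
  (forall x, I x -> is_derive x 1 f (g x)) ->
  (forall x, I x -> {for x, continuous g}) -> AC_deriv I f g.
Proof.
move=> oI cI fg cg; split.
  split => //.
    by apply: open_continuous_measurable_fun => // y; rewrite inE; exact: cg.
  move=> K KI cK.
  suff /integrableP[_] : mu.-integrable K (EFin \o g) by [].
  apply: continuous_compact_integrable => //.
  by apply: continuous_in_subspaceT => y; rewrite inE => /KI; exact: cg.
move=> x y Ix Iy; rewrite le_eqVlt => /predU1P[->|xy].
  by rewrite subrr set_itv1 Rintegral_set1.
have sub t : x <= t <= y -> I t by exact: cI.
rewrite /Rintegral (@continuous_FTC2 _ g f) //.
- apply: continuous_in_subspaceT => t; rewrite inE /= in_itv/= => /sub.
  exact: cg.
- split.
  + move=> t; rewrite in_itv/= => /andP[xt ty].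
    have It : I t by apply: sub; rewrite !ltW.
    by have [] := fg _ It.
  + by apply: cvg_at_right_filter; exact: is_derive_continuous (fg _ Ix).
  + by apply: cvg_at_left_filter; exact: is_derive_continuous (fg _ Iy).
move=> t; rewrite in_itv/= => /andP[xt ty].
have It : I t by apply: sub; rewrite !ltW.
by rewrite derive1E; have [] := fg _ It.
Qed.

End AbsolutelyContinuous.

(** * Eigenfunctions are multiples of the regular solution *)

Section RegularEigenfunctions.
Context {R : realType}.
Local Notation mu := (@lebesgue_measure R).
Local Notation Re := complex.Re.
Local Notation Im := complex.Im.
Local Notation normc := ComplexField.Normc.normc.
Variables (nu h : R).
Hypotheses (nu_gt0 : 0 < nu) (h_gt0 : 0 < h).
Variable (I : set R).
Hypotheses (oI : open I) (cI : is_interval I) (I0 : I `<=` `]0, +oo[)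
  (rI : exists2 r : R, 0 < r & `]0, r[ `<=` I).
Implicit Types (u f : R -> R[i]).

Lemma normc_sqr (z : R[i]) : normc z ^+ 2 = Re z ^+ 2 + Im z ^+ 2.
Proof. by case: z => x y; rewrite /= sqr_sqrtr// addr_ge0 ?sqr_ge0. Qed.

Lemma normc_ge_abs (z : R[i]) : `|Re z| <= normc z /\ `|Im z| <= normc z.
Proof.
have n0 : 0 <= normc z by case: z => x y; exact: sqrtr_ge0.
split; rewrite -(ler_pXn2r (n := 2)) ?nnegrE// real_normK ?num_real// normc_sqr.
  by rewrite lerDl sqr_ge0.
by rewrite lerDr sqr_ge0.
Qed.

Lemma Ipos x : I x -> 0 < x.
Proof. by move=> /I0; rewrite /= in_itv/= andbT. Qed.

Lemma potential_continuous e x : 0 < x ->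
  {for x, continuous (fun x => (potential nu h x - e) / h ^+ 2)}.
Proof.
move=> x0; apply: cvgM; last exact: cvg_cst.
apply: cvgB; last exact: cvg_cst.
apply: cvgD; last by apply: exprn_continuous.
apply: cvgM; first exact: cvg_cst.
by apply: cvgV; [rewrite expf_neq0// gt_eqF|exact: exprn_continuous].
Qed.

(** In the eigenvalue equation the second derivative is almost everywhere a
    continuous function times u, so u is a classical solution.  The
    coefficients are real, so real and imaginary parts separate. *)
Lemma Q_maximal_sol e u : Q_maximal I nu h u (fun x => e%:C%C * u x) ->
  (exists v, ode_sol I (fun x => (potential nu h x - e) / h ^+ 2) (fun x => Re (u x)) v) /\
  (exists v, ode_sol I (fun x => (potential nu h x - e) / h ^+ 2) (fun x => Im (u x)) v).
Proof.
move=> [_ _ [u1 [u2 [[aR aI] [bR bI] ae]]]].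
have aeR : {ae mu, forall x, I x -> Re (u2 x) = (potential nu h x - e) / h ^+ 2 * Re (u x)}.
  apply: (@filterS _ _ (ae_filter_ringOfSetsType mu) _ _ _ ae) => x H Ix; have := congr1 (fun z : R[i] => Re z) (H Ix).
  case: (u x) (u2 x) => [p q] [s t] /=; rewrite !mul0r !subr0 -/(potential nu h x) => E.
  have -> : (potential nu h x - e) / h ^+ 2 * p = (potential nu h x * p - e * p) / h ^+ 2 by ring.
  by rewrite E; field; rewrite gt_eqF.
have aeI : {ae mu, forall x, I x -> Im (u2 x) = (potential nu h x - e) / h ^+ 2 * Im (u x)}.
  apply: (@filterS _ _ (ae_filter_ringOfSetsType mu) _ _ _ ae) => x H Ix; have := congr1 (fun z : R[i] => Im z) (H Ix).
  case: (u x) (u2 x) => [p q] [s t] /=; rewrite !mul0r !addr0 -/(potential nu h x) => E.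
  have -> : (potential nu h x - e) / h ^+ 2 * q = (potential nu h x * q - e * q) / h ^+ 2 by ring.
  by rewrite E; field; rewrite gt_eqF.
have aeT (k : R -> R) : {ae mu, forall x, I x -> k x = k x} by exact: aeW.
split; [exists (fun x => Re (u1 x))|exists (fun x => Im (u1 x))] => x Ix; split.
- apply: (AC_deriv_is_derive aR (aeT _)) => // y; exact: AC_deriv_continuous bR.
- apply: (AC_deriv_is_derive bR aeR) => // y Iy; apply: cvgM.
    exact: potential_continuous (Ipos Iy).
  exact: AC_deriv_continuous aR Iy.
- apply: (AC_deriv_is_derive aI (aeT _)) => // y; exact: AC_deriv_continuous bI.
- apply: (AC_deriv_is_derive bI aeI) => // y Iy; apply: cvgM.
    exact: potential_continuous (Ipos Iy).
  exact: AC_deriv_continuous aI Iy.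
Qed.

(** For nu >= 1 the bound makes |u|^2 at least k^2 / x near 0, whose integral over
    (a, b) is k^2 (ln b - ln a), unbounded as a tends to 0. *)
Lemma L2_no_singular u (v : R -> R) (k r : R) : 1 <= nu -> L2 I u ->
  (forall x, I x -> `|v x| <= normc (u x)) -> 0 < k -> 0 < r ->
  ~ (forall x, 0 < x -> x < r -> k * x `^ (2^-1 - nu) <= `|v x|).
Proof.
move=> nu1 [mR mI fin] vu k0 r0 H; have [r1 r10 r1I] := rI.
pose F x := (normc (u x) ^+ 2)%:E.
have mF : measurable_fun I F.
  apply/measurable_EFinP.
  rewrite (_ : (fun x => _) = (fun x => Re (u x) ^+ 2 + Im (u x) ^+ 2)); last first.
    by apply/funext => x; rewrite normc_sqr.
  by apply: measurable_funD; apply: measurable_funX.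
have F0 x : (0 <= F x)%E by rewrite lee_fin sqr_ge0.
have Ffin : (\int[mu]_(x in I) F x \is a fin_num)%E by rewrite ge0_fin_numE ?integral_ge0.
pose A := fine (\int[mu]_(x in I) F x).
pose b := Num.min (Num.min (r / 2) (r1 / 2)) 1.
have b0 : 0 < b by rewrite !lt_min !divr_gt0/=.
have br : b < r by rewrite !gt_min; apply/orP; left; apply/orP; left; lra.
have br1 : b < r1 by rewrite !gt_min; apply/orP; left; apply/orP; right; lra.
have b1 : b <= 1 by rewrite ge_min lexx orbT.
have A0 : 0 <= A by rewrite fine_ge0// integral_ge0.
(* Chosen so that k^2 (ln b - ln a) = A + 1 exceeds the full integral A. *)
pose a := b * expR (- (A + 1) / k ^+ 2).
have kk : 0 < k ^+ 2 by rewrite exprn_gt0.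
have a0 : 0 < a by rewrite mulr_gt0// expR_gt0.
have ab : a < b.
  rewrite /a gtr_pMr// -[ltRHS]expR0 ltr_expR mulNr oppr_lt0 divr_gt0//; lra.
have abI : `[a, b] `<=` I.
  move=> x /=; rewrite in_itv/= => /andP[ax xb]; apply: r1I.
  by rewrite /= in_itv/= (lt_le_trans a0)//= (le_lt_trans xb).
have step1 : (\int[mu]_(x in `[a, b]) F x <= A%:E)%E.
  by rewrite /A fineK// ge0_subset_integral//; exact: open_measurable.
pose G (x : R) : R := k ^+ 2 / x.
have cG (x : R) : 0 < x -> {for x, continuous G}.
  move=> x0; apply: cvgM; first exact: cvg_cst.
  by apply: cvgV; [rewrite gt_eqF|exact: cvg_id].
have step2 : (\int[mu]_(x in `[a, b]) (G x)%:E <= \int[mu]_(x in `[a, b]) F x)%E.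
  apply: ge0_le_integral => //.
  - by move=> x /=; rewrite in_itv/= lee_fin => /andP[ax _]; rewrite divr_ge0 ?ltW// (lt_le_trans a0).
  - apply/measurable_EFinP; apply: (@measurable_funS _ _ _ _ I) => //.
      exact: open_measurable.
    by apply: open_continuous_measurable_fun => // y; rewrite inE => /Ipos; exact: cG.
  - by apply: measurable_funS mF => //; exact: open_measurable.
  move=> x /[dup] xab /=; rewrite in_itv/= => /andP[ax xb].
  have x0 : 0 < x by exact: lt_le_trans ax.
  rewrite lee_fin /G.
  have h1 := H x x0 (le_lt_trans xb br).
  have h2 := le_trans h1 (vu x (abI _ xab)).
  have p0 : 0 < k * x `^ (2^-1 - nu) by rewrite mulr_gt0// powR_gt0.
  have : (k * x `^ (2^-1 - nu)) ^+ 2 <= normc (u x) ^+ 2.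
    by rewrite lerXn2r ?nnegrE ?(ltW p0)// (le_trans (ltW p0)).
  apply: le_trans; rewrite exprMn ler_pM2l//.
  rewrite -powR_mulrn ?powR_ge0// -powRrM -[x^-1]powR_inv1 ?(ltW x0)//.
  apply: ger_powR; first by rewrite x0 (le_trans xb).
  by rewrite mulrBl mulVf//; lra.
have step3 : (\int[mu]_(x in `[a, b]) (G x)%:E = (k ^+ 2 * ln b)%:E - (k ^+ 2 * ln a)%:E)%E.
  have dl (x : R) : 0 < x -> is_derive x 1 (fun x => k ^+ 2 * ln x) (G x).
    move=> x0; have hl := is_derive1_ln x0.
    exact: is_deriveZ hl.
  apply: (@continuous_FTC2 _ G (fun x => k ^+ 2 * ln x)) => //.
  - apply: continuous_in_subspaceT => t; rewrite inE /= in_itv/= => /andP[at_ _].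
    exact: cG (lt_le_trans a0 at_).
  - split.
    + by move=> t; rewrite in_itv/= => /andP[at_ _]; have [] := dl t (lt_trans a0 at_).
    + by apply: cvg_at_right_filter; exact: is_derive_continuous (dl _ a0).
    + by apply: cvg_at_left_filter; exact: is_derive_continuous (dl _ b0).
  move=> t; rewrite in_itv/= => /andP[at_ _].
  by rewrite derive1E; have [] := dl t (lt_trans a0 at_).
have := le_trans step2 step1; rewrite step3 -EFinB lee_fin /a lnM ?posrE ?expR_gt0//.
rewrite expRK mulrDr opprD addNKr mulrCA mulfV ?gt_eqF//.
lra.
Qed.

(** The powers x^(nu-1/2) and x^(1/2-nu) cancel, so the weighted quantity stays
    above k instead of tending to 0. *)
Lemma left_bc_no_singular u (v : R -> R) (k r : R) : nu < 1 -> left_bc nu u ->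
  (forall x, `|v x| <= normc (u x)) -> 0 < k -> 0 < r ->
  ~ (forall x, 0 < x -> x < r -> k * x `^ (2^-1 - nu) <= `|v x|).
Proof.
move=> nu1 /(_ nu1) bc vu k0 r0 H.
have : \forall x \near 0^'+, `|0 - x `^ (nu - 2^-1) * normc (u x)| < k.
  by move/cvgrPdist_lt : bc; apply.
move=> [d /= d0 Hd].
pose x := Num.min (d / 2) (r / 2).
have x0 : 0 < x by rewrite lt_min !divr_gt0.
have xd : x < d by rewrite gt_min; apply/orP; left; lra.
have xr : x < r by rewrite gt_min; apply/orP; right; lra.
have := Hd x; rewrite /ball/= sub0r normrN gtr0_norm// => /(_ xd x0).
rewrite sub0r normrN; apply/negP; rewrite -leNgt.
apply: le_trans (ler_norm _).
have p0 := powR_gt0 (nu - 2^-1) x0.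
apply: (@le_trans _ _ (x `^ (nu - 2^-1) * (k * x `^ (2^-1 - nu)))).
  rewrite mulrCA -powRD; last by rewrite (gt_eqF x0) implybT.
  by rewrite addrA subrK subrr powRr0 mulr1.
by rewrite ler_wpM2l ?(ltW p0)// (le_trans (H x x0 xr)).
Qed.

Theorem eigenfunction_regular e u :
  Q_maximal I nu h u (fun x => e%:C%C * u x) -> left_bc nu u ->
  exists c : R[i], forall x, I x -> u x = c * (phi nu h e x)%:C%C.
Proof.
move=> Qu bc; have [uL2 _ _] := Qu; have [[v sv] [w sw]] := Q_maximal_sol Qu.
have nsR (k r : R) : 0 < k -> 0 < r ->
    ~ (forall x, 0 < x -> x < r -> k * x `^ (2^-1 - nu) <= `|Re (u x)|).
  have [nu1|nu1] := ltP nu 1.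
    by apply: (left_bc_no_singular nu1 bc) => x; have [] := normc_ge_abs (u x).
  by apply: (L2_no_singular nu1 uL2) => x _; have [] := normc_ge_abs (u x).
have nsI (k r : R) : 0 < k -> 0 < r ->
    ~ (forall x, 0 < x -> x < r -> k * x `^ (2^-1 - nu) <= `|Im (u x)|).
  have [nu1|nu1] := ltP nu 1.
    by apply: (left_bc_no_singular nu1 bc) => x; have [] := normc_ge_abs (u x).
  by apply: (L2_no_singular nu1 uL2) => x _; have [] := normc_ge_abs (u x).
have [c1 H1] := regular_solution nu_gt0 h_gt0 cI I0 rI sv nsR.
have [c2 H2] := regular_solution nu_gt0 h_gt0 cI I0 rI sw nsI.
exists (c1 +i* c2)%C => x Ix.
have := H1 x Ix; have := H2 x Ix; case: (u x) => p q /= -> ->.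
by apply/eqP; rewrite eq_complex /= !mulr0 subr0 add0r !eqxx.
Qed.

End RegularEigenfunctions.

(** * Size of Kummer's function at infinity *)

Section KummerGrowth.
Context {R : realType}.
Implicit Types (a b z : R) (c d : R^nat).

Lemma psum_abs_le c (A rho z : R) : 0 <= z ->
  (forall n, `|c n| <= A * rho ^+ n / n`!%:R) -> `|psum c z| <= A * expR (rho * z).
Proof.
move=> z0 H; have ec : entire c by exists A, rho.
have ee := entire_exp A rho; rewrite -psum_exp ler_norml; apply/andP; split.
  rewrite -mulN1r -psumZ//; apply: psum_le => //; first exact: entireZ.
  by move=> n; have := H n; rewrite ler_norml mulN1r => /andP[].
by apply: psum_le => // n; exact: le_trans (ler_norm _) (H n).
Qed.

(** For a = -k the series is a polynomial.  Any rate below 1/2 in the exponential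
    would do for square integrability; 1/8 leaves room for the powers of x. *)
Lemma kummer_poly_le (k : nat) b : 0 < b -> exists2 A : R, 0 <= A &
  forall z, 0 <= z -> `|kummer (- k%:R) b z| <= A * expR (8^-1 * z).
Proof.
move=> b0; pose c := kummer_coef (- k%:R) b.
exists (\sum_(i < k.+1) `|c i| * i`!%:R * 8 ^+ i).
  by apply: sumr_ge0 => i _; rewrite !mulr_ge0// exprn_ge0.
move=> z z0; apply: psum_abs_le => // n; rewrite -/(c n).
have [nk|kn] := leqP n k; last first.
  have -> : c n = 0.
    rewrite /c /kummer_coef -(subnKC kn) pochD pochS addNr mulr0 !mul0r//.
  rewrite normr0 !mulr_ge0 ?invr_ge0 ?exprn_ge0//.
  by apply: sumr_ge0 => i _; rewrite !mulr_ge0// exprn_ge0.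
rewrite (bigD1 (Ordinal (nk : (n < k.+1)%N)))//= mulrDl mulrDl exprVn.
rewrite (_ : `|c n| * n`!%:R * 8 ^+ n / 8 ^+ n / n`!%:R = `|c n|); last first.
  field; rewrite pnatr_eq0 -lt0n fact_gt0 expf_neq0//.
rewrite lerDl !mulr_ge0 ?invr_ge0 ?exprn_ge0//.
by apply: sumr_ge0 => i _; rewrite !mulr_ge0// exprn_ge0.
Qed.

(** For large n the ratio (a+n)/(b+n) exceeds 3/4, so from some index N on the
    coefficients, which have the sign of (a)_N, dominate C (3/4)^n / n!.  The
    finitely many others are absorbed by a multiple of (1/2)^n / n!.  Summing,
    |M| >= C exp(3z/4) - D exp(z/2). *)
Lemma kummer_growth a b : 0 < b -> (forall k : nat, a != - k%:R) ->
  exists Z : R, forall z, Z <= z -> expR (z / 2) <= `|kummer a b z|.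
Proof.
move=> b0 ank.
have [N N4] : exists N : nat, 4 * `|a| + 3 * b < N%:R.
  by exists (Num.truncn (4 * `|a| + 3 * b)).+1; exact: truncnS_gt.
have aN : 0 < a + N%:R.
  have := ler_norm (- a); rewrite normrN; have := normr_ge0 a; move: b0; lra.
have bN : 0 < b + N%:R by rewrite ltr_wpDr.
have ratio n : (3 / 4) ^+ n * poch (b + N%:R) n <= poch (a + N%:R) n.
  elim: n => [|n IH]; first by rewrite !poch0 mulr1.
  rewrite !pochS exprSr mulrACA ler_pM//.
  - by rewrite mulr_ge0 ?exprn_ge0// ?(ltW (poch_gt0 _ bN))//; lra.
  - by have := ler0n R n; move: bN; lra.
  have := ler_norm (- a); rewrite normrN; have := normr_ge0 a; have := ler0n R n; move: b0; lra.
pose C0 := poch a N / poch b N.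
have C00 : C0 != 0.
  apply: mulf_neq0; last by rewrite invr_neq0// gt_eqF// poch_gt0.
  by apply: poch_neq0 => i _; rewrite addr_eq0.
pose sg : R := Num.sg C0.
have sC : sg * C0 = `|C0| by rewrite /sg -normrEsg.
have C0p : 0 < `|C0| by rewrite normr_gt0.
pose c := kummer_coef a b.
have cE n : sg * c (N + n)%N = `|C0| * (poch (a + N%:R) n / poch (b + N%:R) n) / (N + n)`!%:R.
  by rewrite /c /kummer_coef !pochD -sC /C0 !invfM; ring.
(* Large enough that D (1/2)^i / i! outweighs both the i-th coefficient and its
   model C (3/4)^i / i!, for every i < N. *)
pose D : R := \sum_(i < N) (2 ^+ i * i`!%:R * (`|c i| + `|C0| * (3 / 4) ^+ i / i`!%:R)).
have q0 : 0 <= (3 / 4 : R) by lra.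
have D0 : 0 <= D.
  by apply: sumr_ge0 => i _; rewrite !mulr_ge0 ?exprn_ge0// addr_ge0// !mulr_ge0 ?invr_ge0 ?exprn_ge0.
have low n : `|C0| * (3 / 4) ^+ n / n`!%:R - D * 2^-1 ^+ n / n`!%:R <= sg * c n.
  have nf : 0 < (n`!%:R : R) by rewrite ltr0n fact_gt0.
  have [Nn|nN] := leqP N n.
    rewrite -(subnKC Nn); set m := (n - N)%N; rewrite cE.
    rewrite lerBlDr ler_wpDr//.
      by rewrite !mulr_ge0 ?invr_ge0 ?exprn_ge0// invr_ge0.
    rewrite ler_wpM2r ?invr_ge0// ler_wpM2l//.
    rewrite ler_pdivlMr ?poch_gt0//; apply: le_trans (ratio m).
    rewrite ler_wpM2r ?(ltW (poch_gt0 _ bN))// exprD ler_piMl ?exprn_ge0//.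
    by rewrite exprn_ile1//; lra.
  have : - `|c n| <= sg * c n.
    rewrite /sg; case: sgrP => ?; rewrite ?mul0r ?oppr_le0// ?mul1r ?mulN1r ?lerN2 ?ler_norm//.
    by rewrite lerNl -normrN ler_norm.
  apply: le_trans; rewrite lerBlDr.
  have : 2 ^+ n * n`!%:R * (`|c n| + `|C0| * (3 / 4) ^+ n / n`!%:R) <= D.
    rewrite /D (bigD1 (Ordinal nN))//= lerDl.
    by apply: sumr_ge0 => i _; rewrite !mulr_ge0 ?exprn_ge0// addr_ge0// !mulr_ge0 ?invr_ge0 ?exprn_ge0.
  have p0 : 0 < 2^-1 ^+ n / n`!%:R :> R by rewrite divr_gt0// exprn_gt0// invr_gt0.
  move=> /(ler_wpM2r (ltW p0)) h; rewrite -lerBlDl opprK -[D * _ / _]mulrA.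
  apply: le_trans h; rewrite exprVn le_eqVlt; apply/orP; left; apply/eqP.
  by field; rewrite expf_neq0// gt_eqF.
have ec : entire c by exact: entire_kummer.
exists (4 * (D + 1) / `|C0|) => z Zz.
have z0 : 0 <= z by apply: le_trans Zz; rewrite divr_ge0 ?mulr_ge0 ?addr_ge0 ?(ltW C0p).
have : `|C0| * expR (3 / 4 * z) - D * expR (2^-1 * z) <= `|kummer a b z|.
  apply: (@le_trans _ _ (sg * kummer a b z)).
    rewrite -!psum_exp -psumB; try exact: entire_exp.
    rewrite -psumZ//; apply: psum_le => //; last exact: entireZ.
    by apply: entireB; exact: entire_exp.
  apply: le_trans (ler_norm _) _; rewrite normrM ler_piMl//.
  by rewrite normr_sg C00.
apply: le_trans; rewrite [2^-1 * z]mulrC.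
have -> : 3 / 4 * z = z / 4 + z / 2 by field.
rewrite expRD mulrA -mulrBl ler_peMl ?expR_ge0// lerBrDr.
have := expR_ge1Dx (z / 4) => h.
move: Zz; rewrite ler_pdivrMr// => Zz.
have : `|C0| * (z / 4) <= `|C0| * expR (z / 4) by rewrite ler_wpM2l//; lra.
lra.
Qed.

End KummerGrowth.

(** * When the regular solution is an eigenfunction *)

Section PhiEigenfunction.
Context {R : realType}.
Local Notation mu := (@lebesgue_measure R).
Local Notation Re := complex.Re.
Local Notation Im := complex.Im.
Local Notation normc := ComplexField.Normc.normc.
Variables (nu h : R).
Hypotheses (nu_gt0 : 0 < nu) (h_gt0 : 0 < h).
Implicit Types (I : set R) (e x : R).

Definition phiC e (x : R) : R[i] := (phi nu h e x)%:C%C.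

Lemma normc_real (r : R) : normc r%:C%C = `|r|.
Proof. by rewrite /= expr0n/= addr0 sqrtr_sqr. Qed.

Lemma phi_continuous e x : 0 < x -> {for x, continuous (phi nu h e)}.
Proof. by move=> x0; exact: is_derive_continuous (phi_is_derive _ _ e x0). Qed.

Lemma measurable_phi I e : open I -> I `<=` `]0, +oo[ ->
  measurable_fun I (phi nu h e).
Proof.
move=> oI I0; apply: open_continuous_measurable_fun => // x; rewrite inE => /I0.
by rewrite /= in_itv/= andbT; exact: phi_continuous.
Qed.

Lemma L2_real I (g : R -> R) : measurable_fun I g ->
  (\int[mu]_(x in I) (g x ^+ 2)%:E < +oo)%E -> L2 I (fun x => (g x)%:C%C).
Proof.
move=> mg fin; split; [exact: mg|exact: measurable_cst|rewrite /=].
under eq_integral do rewrite expr0n/= addr0 sqrtr_sqr real_normK ?num_real//.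
exact: fin.
Qed.

Lemma phiC_eigen I e : open I -> is_interval I -> I `<=` `]0, +oo[ ->
  (\int[mu]_(x in I) (phi nu h e x ^+ 2)%:E < +oo)%E ->
  Q_maximal I nu h (phiC e) (fun x => e%:C%C * phiC e x).
Proof.
move=> oI cI I0 fin; have mphi := measurable_phi e oI I0.
have I0' x : I x -> 0 < x by move=> /I0; rewrite /= in_itv/= andbT.
have mI : measurable I by exact: open_measurable.
have c0 x : I x -> {for x, continuous (fun=> 0 : R)} by move=> _; exact: cst_continuous.
have d0 x : I x -> is_derive x 1 (fun=> 0 : R) 0 by move=> _; exact: is_derive_cst.
split.
- exact: L2_real.
- rewrite (_ : (fun x => _) = (fun x => (e * phi nu h e x)%:C%C)); last first.
    by apply/funext => x; rewrite rmorphM.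
  apply: L2_real; first exact: measurable_funM.
  under eq_integral do rewrite exprMn EFinM.
  rewrite ge0_integralZl_EFin ?sqr_ge0//.
  - by rewrite lte_mul_pinfty ?lee_fin ?sqr_ge0.
  - by move=> x _; rewrite lee_fin sqr_ge0.
  - by apply/measurable_EFinP; exact: measurable_funX.
pose V x := (potential nu h x - e) / h ^+ 2.
have cV x : 0 < x -> {for x, continuous (fun x => V x * phi nu h e x)}.
  by move=> x0; apply: cvgM; [exact: potential_continuous|exact: phi_continuous].
exists (fun x => (phi1 nu h e x)%:C%C), (fun x => (V x * phi nu h e x)%:C%C); split.
- split => /=; last exact: AC_deriv_of_derive.
  apply: AC_deriv_of_derive => // x /I0' x0; first exact: phi_is_derive.
  exact: is_derive_continuous (phi1_is_derive nu_gt0 h_gt0 e x0).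
- split => /=; last exact: AC_deriv_of_derive.
  apply: (@AC_deriv_of_derive _ I (phi1 nu h e) (fun x => V x * phi nu h e x) oI cI) => x /I0' x0.
    exact: (phi1_is_derive nu_gt0 h_gt0 e x0).
  exact: cV.
apply: aeW => x Ix; rewrite -/(potential nu h x) /phiC -rmorphN -!rmorphM -rmorphD/=.
congr (_%:C)%C; rewrite /V; field; by rewrite gt_eqF.
Qed.

(** Here the two powers of x combine to x^(2 nu). *)
Lemma phiC_left_bc e : left_bc nu (phiC e).
Proof.
move=> _; have [r r0 H] := phi_bounds h nu_gt0 e.
have c2 : 0 < 2 * nu by rewrite mulr_gt0.
have : 2 * x `^ (2 * nu) @[x --> 0^'+] --> (0 : R).
  by rewrite -[X in _ --> X](mulr0 2); apply: cvgMr; exact: powR_cvg0.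
apply: squeeze_cvgr (cvg_cst (0 : R)).
near=> x.
have x0 : 0 < x by [].
have xr : x < r by near: x; exact: nbhs_right_lt.
have /andP[h1 h2] := H x x0 xr.
have p0 := powR_gt0 (nu + 2^-1) x0; have q0 := powR_gt0 (nu - 2^-1) x0.
have f0 : 0 <= phi nu h e x by rewrite (le_trans _ h1)// divr_ge0// ltW.
rewrite /phiC normc_real ger0_norm// mulr_ge0 ?(ltW q0)//=.
apply: (@le_trans _ _ (x `^ (nu - 2^-1) * (2 * x `^ (nu + 2^-1)))).
  by rewrite ler_wpM2l// ltW.
rewrite mulrCA -powRD ?(gt_eqF x0) ?implybT// (_ : nu - 2^-1 + _ = 2 * nu)//.
by ring.
Unshelve. all: end_near. Qed.

Lemma phi_abs_le e : exists A rho : R, [/\ 0 <= A, 0 <= rho & forall x, 0 < x ->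
  `|phi nu h e x| <= x `^ (nu + 2^-1) * (A * expR (rho * (x ^+ 2 / h)))].
Proof.
have b0 : 0 < nu + 1 by rewrite addr_gt0.
have [A [rho [A0 rho0 H]]] := entire_ge0 (entire_kummer (kummer_param nu h e) b0).
exists A, rho; split => // x x0; rewrite /phi normrM /prefactor normrM.
rewrite (ger0_norm (powR_ge0 _ _)) -mulrA ler_wpM2l ?powR_ge0//.
rewrite (ger0_norm (expR_ge0 _)) -[leRHS]mul1r ler_pM ?expR_ge0//.
  by rewrite -expR0 ler_expR mulNr oppr_le0 divr_ge0 ?sqr_ge0// mulr_ge0// ltW.
by apply: psum_abs_le H; rewrite divr_ge0 ?sqr_ge0// ltW.
Qed.

Lemma phi_L2_bounded e (L : R) : 0 < L ->
  (\int[mu]_(x in `]0%R, L[) (phi nu h e x ^+ 2)%:E < +oo)%E.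
Proof.
move=> L0; have [A [rho [A0 rho0 H]]] := phi_abs_le e.
pose B := L `^ (nu + 2^-1) * (A * expR (rho * (L ^+ 2 / h))).
have mphi : measurable_fun `]0, L[ (phi nu h e).
  by apply: measurable_phi => //; apply: subset_itvl; rewrite bnd_simp.
apply: (@le_lt_trans _ _ (\int[mu]_(x in `]0%R, L[) (B ^+ 2)%:E)%E).
  apply: ge0_le_integral => //.
  - by move=> x _; rewrite lee_fin sqr_ge0.
  - by apply/measurable_EFinP; exact: measurable_funX.
  move=> x /=; rewrite in_itv/= lee_fin => /andP[x0 xL].
  rewrite -real_normK ?num_real// lerXn2r ?nnegrE//.
    by rewrite !mulr_ge0 ?powR_ge0 ?expR_ge0.
  apply: le_trans (H x x0) _; rewrite /B ler_pM ?powR_ge0 ?mulr_ge0 ?expR_ge0//.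
    by rewrite ge0_ler_powR ?nnegrE ?(ltW x0) ?(ltW L0) ?(ltW xL)// addr_ge0 ?invr_ge0 ?(ltW nu_gt0).
  rewrite ler_wpM2l// ler_expR ler_wpM2l// ler_wpM2r ?invr_ge0 ?(ltW h_gt0)//.
  by rewrite lerXn2r ?nnegrE ?(ltW x0) ?(ltW L0) ?(ltW xL).
rewrite integral_cst//= lebesgue_measure_itv/= lte_fin L0 -EFinB -EFinM.
by rewrite ltry.
Qed.

Lemma phi_vanish e (L : R) : 0 < L ->
  phi nu h e L = 0 <-> kummer (kummer_param nu h e) (nu + 1) (L ^+ 2 / h) = 0.
Proof.
move=> L0; rewrite /phi; split=> [/eqP|->]; last by rewrite mulr0.
by rewrite mulf_eq0 gt_eqF ?mulr_gt0 ?powR_gt0 ?expR_gt0//= => /eqP.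
Qed.

(** The Gaussian factor exp(-x^2/h) of phi^2 beats the polynomial M^2 and the
    power of x; an integrable exponential majorant suffices. *)
Lemma phi_L2_halfline e (k : nat) : kummer_param nu h e = - k%:R ->
  (\int[mu]_(x in `]0%R, +oo[) (phi nu h e x ^+ 2)%:E < +oo)%E.
Proof.
move=> ek; have b0 : 0 < nu + 1 by rewrite addr_gt0.
have [A A0 HA] := kummer_poly_le k b0.
have s0 : 0 < (nu + 2^-1) * 2 by rewrite mulr_gt0// addr_gt0.
have [C C0 HC] := powR_le_expR s0.
pose B := A ^+ 2 * C * expR (4 * h / 3).
have B0 : 0 <= B by rewrite !mulr_ge0 ?sqr_ge0 ?(ltW C0) ?expR_ge0.
have mphi : measurable_fun `](0 : R), +oo[ (phi nu h e) by exact: measurable_phi.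
have bound x : 0 < x -> phi nu h e x ^+ 2 <= B * expR (- x).
  move=> x0; rewrite /phi /prefactor ek !exprMn.
  have h1 : kummer (- k%:R) (nu + 1) (x ^+ 2 / h) ^+ 2 <= A ^+ 2 * expR (x ^+ 2 / (4 * h)).
    have z0 : 0 <= x ^+ 2 / h by rewrite divr_ge0 ?sqr_ge0// ltW.
    have hz := HA _ z0.
    apply: (@le_trans _ _ ((A * expR (8^-1 * (x ^+ 2 / h))) ^+ 2)).
      by rewrite -[leLHS]real_normK ?num_real// lerXn2r ?nnegrE ?mulr_ge0 ?expR_ge0.
    rewrite exprMn -expRM_natl ler_wpM2l ?sqr_ge0// ler_expR.
    by rewrite le_eqVlt; apply/orP; left; apply/eqP; field; rewrite gt_eqF.
  have h2 : (x `^ (nu + 2^-1)) ^+ 2 <= C * expR x.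
    by rewrite -powR_mulrn ?powR_ge0// -powRrM; exact: HC.
  have h3 : expR (- x ^+ 2 / (2 * h)) ^+ 2 = expR (- (x ^+ 2 / h)).
    by rewrite -expRM_natl; congr expR; field; rewrite gt_eqF.
  rewrite h3.
  apply: (@le_trans _ _ (C * expR x * expR (- (x ^+ 2 / h)) * (A ^+ 2 * expR (x ^+ 2 / (4 * h))))).
    apply: ler_pM h1; [|exact: sqr_ge0|].
      by rewrite mulr_ge0 ?sqr_ge0 ?expR_ge0.
    by rewrite ler_wpM2r ?expR_ge0.
  rewrite (_ : _ * _ = A ^+ 2 * C * (expR x * expR (- (x ^+ 2 / h)) * expR (x ^+ 2 / (4 * h)))); last by ring.
  rewrite /B -[leRHS]mulrA ler_wpM2l ?mulr_ge0 ?sqr_ge0 ?(ltW C0)//.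
  rewrite -!expRD ler_expR.
  (* Completing the square: 2 x - 3 x^2/(4h) <= 4h/3. *)
  have : 0 <= (3 * x - 4 * h) ^+ 2 / (12 * h) by rewrite divr_ge0 ?sqr_ge0// mulr_ge0// ltW.
  have -> : (3 * x - 4 * h) ^+ 2 / (12 * h) = 3 * (x ^+ 2 / (4 * h)) - 2 * x + 4 * h / 3.
    by field; rewrite gt_eqF.
  have -> : x ^+ 2 / h = 4 * (x ^+ 2 / (4 * h)) by field; rewrite gt_eqF.
  lra.
have cE (x : R) : {for x, continuous (fun x => expR (- x))}.
  by apply: (@continuous_comp _ _ _ -%R expR); [exact: opp_continuous|exact: continuous_expR].
apply: (@le_lt_trans _ _ (\int[mu]_(x in `]0%R, +oo[) (B * expR (- x))%:E)%E).
  apply: ge0_le_integral => //.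
  - by move=> x _; rewrite lee_fin sqr_ge0.
  - by apply/measurable_EFinP; exact: measurable_funX.
  - apply/measurable_EFinP; apply: open_continuous_measurable_fun => // x _.
    by apply: cvgM; [exact: cvg_cst|exact: cE].
  by move=> x /=; rewrite in_itv/= andbT lee_fin; exact: bound.
apply: (@le_lt_trans _ _ (\int[mu]_(x in `[0%R, +oo[) (B * expR (- x))%:E)%E).
  apply: ge0_subset_integral => //.
  - apply/measurable_EFinP; apply: (@measurable_funS _ _ _ _ setT) => //; apply: continuous_measurable_fun => x.
    by apply: cvgM; [exact: cvg_cst|exact: cE].
  - by move=> x _; rewrite lee_fin mulr_ge0 ?expR_ge0.
  by apply: subset_itvr; rewrite bnd_simp.
have dF (x : R) : is_derive x 1 (fun x => - B * expR (- x)) (B * expR (- x)).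
  have h1 := @is_derive1_comp _ expR -%R x _ _ (is_derive_expR (- x)) (is_deriveNid x 1).
  by apply: is_derive_eq (is_deriveZ (- B) h1) _; rewrite /GRing.scale/=; ring.
rewrite (@ge0_continuous_FTC2y R _ (fun x => - B * expR (- x)) 0 0) ?ltry//.
- by move=> x _; rewrite mulr_ge0 ?expR_ge0.
- apply: continuous_in_subspaceT => x _.
  by apply: cvgM; [exact: cvg_cst|exact: cE].
- by rewrite -[X in _ --> X](mulr0 (- B)); apply: cvgMr; exact: cvgr_expR.
- by apply: cvg_at_right_filter; exact: is_derive_continuous (dF 0).
by move=> x _; rewrite derive1E; have [] := dF x.
Qed.

End PhiEigenfunction.

(** * Square integrability, independence and the m-th eigenvalue *)

Section Spectrum.
Context {R : realType}.
Local Notation mu := (@lebesgue_measure R).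
Local Notation Re := complex.Re.
Local Notation Im := complex.Im.
Local Notation normc := ComplexField.Normc.normc.
Variables (nu h : R).
Hypotheses (nu_gt0 : 0 < nu) (h_gt0 : 0 < h).
Implicit Types (I : set R) (e x : R).

(** By [kummer_growth] the growth of M cancels the Gaussian factor, so phi^2 >= 1
    for all large x. *)
Lemma phi_not_L2_halfline e : (forall k : nat, kummer_param nu h e != - k%:R) ->
  ~ (\int[mu]_(x in `]0%R, +oo[) (phi nu h e x ^+ 2)%:E < +oo)%E.
Proof.
move=> ek fin; have b0 : 0 < nu + 1 by rewrite addr_gt0.
have [Z HZ] := kummer_growth b0 ek.
pose X : R := 1 + h * `|Z|.
have X1 : 1 <= X by rewrite lerDl mulr_ge0 ?normr_ge0// ltW.
have big x : X <= x -> 1 <= phi nu h e x ^+ 2.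
  move=> Xx; have x1 : 1 <= x by exact: le_trans Xx.
  have x0 : 0 < x by exact: lt_le_trans x1.
  have Zz : Z <= x ^+ 2 / h.
    rewrite ler_pdivlMr//; apply: le_trans (_ : x <= _); last by rewrite expr2 ler_peMr// ltW.
    apply: le_trans Xx; rewrite /X mulrC.
    have : h * Z <= h * `|Z| by rewrite ler_wpM2l ?ler_norm// ltW.
    lra.
  have := HZ _ Zz; set K := kummer _ _ _ => hK.
  rewrite -[leRHS]real_normK ?num_real// -[1](expr1n _ 2) lerXn2r ?nnegrE//.
  rewrite /phi -/K normrM /prefactor normrM (ger0_norm (powR_ge0 _ _)) (ger0_norm (expR_ge0 _)).
  apply: (@le_trans _ _ (x `^ (nu + 2^-1) * expR (- x ^+ 2 / (2 * h)) * expR (x ^+ 2 / h / 2))); last first.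
    by rewrite ler_wpM2l// mulr_ge0 ?powR_ge0 ?expR_ge0.
  rewrite -mulrA -expRD.
  have -> : - x ^+ 2 / (2 * h) + x ^+ 2 / h / 2 = 0 by field; rewrite gt_eqF.
  rewrite expR0 mulr1; apply: (@le_trans _ _ (x `^ 0)); first by rewrite powRr0.
  by apply: ler_powR => //; rewrite addr_ge0 ?invr_ge0 ?(ltW nu_gt0).
have mphi : measurable_fun `](0 : R), +oo[ (phi nu h e) by exact: measurable_phi.
have mF : measurable_fun `](0 : R), +oo[ (fun x => (phi nu h e x ^+ 2)%:E).
  by apply/measurable_EFinP; exact: measurable_funX.
set A := (\int[mu]_(x in _) _)%E in fin.
have A0 : (0 <= A)%E by apply: integral_ge0 => x _; rewrite lee_fin sqr_ge0.
have Af : A \is a fin_num by rewrite ge0_fin_numE.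
pose Y := X + fine A + 1.
have fA : 0 <= fine A by rewrite fine_ge0.
have XY : X < Y by rewrite /Y; lra.
have sub : `[X, Y] `<=` `](0 : R), +oo[.
  move=> x /=; rewrite !in_itv/= andbT => /andP[Xx _]; exact: lt_le_trans (lt_le_trans ltr01 X1) Xx.
have : ((Y - X)%:E <= A)%E.
  apply: (@le_trans _ _ (\int[mu]_(x in `[X, Y]) (phi nu h e x ^+ 2)%:E)%E); last first.
    by apply: ge0_subset_integral => // x _; rewrite lee_fin sqr_ge0.
  have -> : (Y - X)%:E = (\int[mu]_(x in `[X, Y]) (1%:E))%E.
    by rewrite integral_cst//= lebesgue_measure_itv/= lte_fin XY -EFinB mul1e.
  apply: ge0_le_integral => //.
    by apply: measurable_funS mF.
  by move=> x /=; rewrite in_itv/= lee_fin => /andP[Xx _]; exact: big.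
rewrite -(fineK Af) lee_fin /Y; lra.
Qed.

(** A null set contains no interval. *)
Lemma ae_zero_continuous I (g : R -> R) : open I ->
  {ae mu, forall x, I x -> g x = 0} ->
  (forall x, I x -> {for x, continuous g}) -> forall x, I x -> g x = 0.
Proof.
move=> oI [A [mA A0 HA]] cg x Ix; apply: contrapT => gx.
have gx0 : 0 < `|g x| by rewrite normr_gt0; exact/eqP.
have n1 : \forall y \near x, I y by exact: open_nbhs_nbhs.
have n2 : \forall y \near x, `|g x - g y| < `|g x|.
  by move/cvgrPdist_lt : (cg x Ix); apply.
have /nbhs_ballP[r /= r0 Hr] : \forall y \near x, A y.
  apply: filterS2 n1 n2 => y Iy gy; apply: HA => /= /(_ Iy) g0.
  by move: gy; rewrite g0 subr0 ltxx.
have : (mu (ball x r) <= 0)%E.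
  by rewrite -A0 le_measure ?inE//; exact: measurable_ball.
have xr : x - r < x + r by lra.
rewrite ball_itv lebesgue_measure_itv/= lte_fin xr.
rewrite -EFinB lee_fin; lra.
Qed.

Lemma derive_of_zero I (g : R -> R) (d x : R) : open I -> (forall x, I x -> g x = 0) ->
  I x -> is_derive x 1 g d -> d = 0.
Proof.
move=> oI g0 Ix [_ <-].
have n1 : \forall y \near x, I y by exact: open_nbhs_nbhs.
rewrite (@near_eq_derive _ _ _ g (cst 0)) ?derive_cst//.
by apply: filterS n1 => y /g0.
Qed.

(** Differentiating the relation twice multiplies the i-th term by
    (potential - lam i)/h^2; so the relation persists with r i replaced by
    r i * lam i, hence by r i * p(lam i) for every polynomial p.  Taking for p a
    polynomial that vanishes at all the lam j but one isolates a single term,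
    and phi is positive near 0. *)
Lemma phi_independent_real I n (lam : 'I_n -> R) (r : 'I_n -> R) :
  open I -> I `<=` `]0, +oo[ -> (exists2 r : R, 0 < r & `]0, r[ `<=` I) ->
  injective lam ->
  (forall x, I x -> \sum_(i < n) r i * phi nu h (lam i) x = 0) -> forall i, r i = 0.
Proof.
move=> oI I0 [rr rr0 rrI] ilam S0 i.
have Ipos x : I x -> 0 < x by move=> /I0; rewrite /= in_itv/= andbT.
pose T k x := \sum_(i < n) r i * lam i ^+ k * phi nu h (lam i) x.
pose T1 k x := \sum_(i < n) r i * lam i ^+ k * phi1 nu h (lam i) x.
pose T2 k x := \sum_(i < n) r i * lam i ^+ k * ((potential nu h x - lam i) / h ^+ 2 * phi nu h (lam i) x).
have dT k x : 0 < x -> is_derive x 1 (T k) (T1 k x).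
  move=> x0; rewrite /T1.
  have -> : T k = \sum_(i < n) ((r i * lam i ^+ k) *: phi nu h (lam i)).
    by apply/funext => y; rewrite fct_sumE.
  apply: is_derive_sum => j; exact: is_deriveZ (phi_is_derive _ _ _ x0).
have dT1 k x : 0 < x -> is_derive x 1 (T1 k) (T2 k x).
  move=> x0; rewrite /T2.
  have -> : T1 k = \sum_(i < n) ((r i * lam i ^+ k) *: phi1 nu h (lam i)).
    by apply/funext => y; rewrite fct_sumE.
  apply: is_derive_sum => j; exact: is_deriveZ (phi1_is_derive _ _ _ x0).
have Tk0 k x : I x -> T k x = 0.
  elim: k x => [|k IH] x Ix.
    by rewrite -[RHS](S0 x Ix); apply: eq_bigr => j _; rewrite expr0 mulr1.
  have T10 y : I y -> T1 k y = 0.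
    by move=> Iy; exact: (derive_of_zero oI IH Iy (dT k y (Ipos y Iy))).
  have T20 : T2 k x = 0.
    exact: (derive_of_zero oI T10 Ix (dT1 k x (Ipos x Ix))).
  have : T2 k x = (potential nu h x * T k x - T k.+1 x) / h ^+ 2.
    rewrite /T2 /T mulr_sumr -sumrB mulr_suml; apply: eq_bigr => j _.
    by rewrite [lam j ^+ k.+1]exprS; ring.
  rewrite T20 IH// mulr0 sub0r => /esym/eqP.
  by rewrite mulf_eq0 oppr_eq0 invr_eq0 expf_eq0 (gt_eqF h_gt0) andbF orbF => /eqP.
have Tp (p : {poly R}) x : I x -> \sum_(j < n) r j * p.[lam j] * phi nu h (lam j) x = 0.
  move=> Ix; transitivity (\sum_(k < size p) p`_k * T k x); last first.
    by apply: big1 => k _; rewrite Tk0// mulr0.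
  under [RHS]eq_bigr do rewrite /T mulr_sumr.
  rewrite exchange_big/=; apply: eq_bigr => j _.
  rewrite horner_coef mulr_sumr mulr_suml; apply: eq_bigr => k _; ring.
(* The unnormalized Lagrange polynomial of the node lam i. *)
pose p : {poly R} := \prod_(j < n | j != i) ('X - (lam j)%:P).
have pi0 : p.[lam i] != 0.
  rewrite horner_prod; apply/prodf_neq0 => j ji; rewrite hornerXsubC subr_eq0.
  by apply: contra ji => /eqP/ilam ->.
have pj0 j : j != i -> p.[lam j] = 0.
  by move=> ji; rewrite horner_prod (bigD1 j)//= hornerXsubC subrr mul0r.
have [rf rf0 Hf] := phi_bounds h nu_gt0 (lam i).
pose x := Num.min (rr / 2) (rf / 2).
have x0 : 0 < x by rewrite lt_min !divr_gt0.
have xr : x < rr by rewrite gt_min; apply/orP; left; lra.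
have xf : x < rf by rewrite gt_min; apply/orP; right; lra.
have Ix : I x by apply: rrI; rewrite /= in_itv/= x0.
have := Tp p x Ix; rewrite (bigD1 i)//= big1 ?addr0; last first.
  by move=> j ji; rewrite pj0// mulr0 mul0r.
have /andP[f1 _] := Hf x x0 xf.
have f0 : 0 < phi nu h (lam i) x by apply: lt_le_trans f1; rewrite divr_gt0// powR_gt0.
by move/eqP; rewrite mulf_eq0 (gt_eqF f0) orbF mulf_eq0 (negPf pi0) orbF => /eqP.
Qed.

Lemma Re_sum n (F : 'I_n -> R[i]) : Re (\sum_(i < n) F i) = \sum_(i < n) Re (F i).
Proof.
by apply: (big_ind2 (fun (z : R[i]) (r : R) => Re z = r)) => // -[x1 y1] x2 [z1 w1] w2 /= -> ->.
Qed.

Lemma Im_sum n (F : 'I_n -> R[i]) : Im (\sum_(i < n) F i) = \sum_(i < n) Im (F i).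
Proof.
by apply: (big_ind2 (fun (z : R[i]) (r : R) => Im z = r)) => // -[x1 y1] x2 [z1 w1] w2 /= -> ->.
Qed.

Lemma sum_phi_continuous n (lam r : 'I_n -> R) x : 0 < x ->
  {for x, continuous (fun x => \sum_(i < n) r i * phi nu h (lam i) x)}.
Proof.
move=> x0.
have d : is_derive x 1 (fun x => \sum_(i < n) r i * phi nu h (lam i) x)
   (\sum_(i < n) r i * phi1 nu h (lam i) x).
  have -> : (fun x => \sum_(i < n) r i * phi nu h (lam i) x) =
      \sum_(i < n) (r i *: phi nu h (lam i)).
    by apply/funext => y; rewrite fct_sumE.
  apply: is_derive_sum => j; exact: is_deriveZ (phi_is_derive _ _ _ x0).
exact: is_derive_continuous d.
Qed.

Lemma phiC_independent I n (lam : 'I_n -> R) :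
  open I -> I `<=` `]0, +oo[ -> (exists2 r : R, 0 < r & `]0, r[ `<=` I) ->
  injective lam -> L2_independent I (fun i => phiC nu h (lam i)).
Proof.
move=> oI I0 rI ilam c ae.
have Ipos x : I x -> 0 < x by move=> /I0; rewrite /= in_itv/= andbT.
have HR : {ae mu, forall x, I x -> \sum_(i < n) Re (c i) * phi nu h (lam i) x = 0}.
  apply: (@filterS _ _ (ae_filter_ringOfSetsType mu) _ _ _ ae) => x H Ix.
  have := congr1 (fun z : R[i] => Re z) (H Ix); rewrite Re_sum /= => E; rewrite -[RHS]E.
  by apply: eq_bigr => i _; case: (c i) => p q /=; rewrite mulr0 subr0.
have HI : {ae mu, forall x, I x -> \sum_(i < n) Im (c i) * phi nu h (lam i) x = 0}.
  apply: (@filterS _ _ (ae_filter_ringOfSetsType mu) _ _ _ ae) => x H Ix.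
  have := congr1 (fun z : R[i] => Im z) (H Ix); rewrite Im_sum /= => E; rewrite -[RHS]E.
  by apply: eq_bigr => i _; case: (c i) => p q /=; rewrite mulr0 add0r.
have cR := ae_zero_continuous oI HR (fun x Ix => @sum_phi_continuous n lam _ x (Ipos x Ix)).
have cI := ae_zero_continuous oI HI (fun x Ix => @sum_phi_continuous n lam _ x (Ipos x Ix)).
move=> i; have := phi_independent_real oI I0 rI ilam cR i.
have := phi_independent_real oI I0 rI ilam cI i.
by case: (c i) => p q /= -> ->.
Qed.

(** The eigenvalues are the [lamk k] and each is simple.  Hence m + 1 independent
    eigenfunctions below [lamk m] would inject m + 1 indices into m levels. *)
Lemma mth_eigenvalue_of_regular I (A : operator) (lamk : nat -> R) m :
  open I -> I `<=` `]0, +oo[ -> (exists2 r : R, 0 < r & `]0, r[ `<=` I) ->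
  (forall k, (k < m)%N -> lamk k < lamk k.+1) ->
  (forall k, (k <= m)%N -> eigenfunction A (lamk k) (phiC nu h (lamk k))) ->
  (forall e u, eigenfunction A e u ->
     exists2 c : R[i], (forall x, I x -> u x = c * phiC nu h e x) &
       c != 0 -> e < lamk m -> exists2 k, (k < m)%N & e = lamk k) ->
  mth_eigenvalue I A m (lamk m).
Proof.
move=> oI I0 rI mono eig cls.
have mono2 i j : (i < j)%N -> (j <= m)%N -> lamk i < lamk j.
  elim: j => // j IH; rewrite ltnS leq_eqVlt => /predU1P[->|ij] jm.
    exact: mono.
  exact: lt_trans (IH ij (ltnW jm)) (mono j jm).
split.
  exists (fun i : 'I_m.+1 => lamk i), (fun i => phiC nu h (lamk i)); split.
    move=> i; have im : (i <= m)%N by rewrite -ltnS.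
    split; last exact: eig.
    rewrite /=; move: im; rewrite leq_eqVlt => /predU1P[->//|im].
    by rewrite ltW// mono2.
  apply: phiC_independent => // i j lij; apply/val_inj/eqP.
  case: ltngtP => // ij; exfalso; move: lij.
    by move=> e; have := mono2 _ _ ij; rewrite -ltnS ltn_ord e ltxx => /(_ isT).
  by move=> e; have := mono2 _ _ ij; rewrite -ltnS ltn_ord e ltxx => /(_ isT).
move=> [lam [u [lu ind]]].
have [c Hc] : exists c : 'I_m.+1 -> R[i], forall i,
    (forall x, I x -> u i x = c i * phiC nu h (lam i) x) /\
     (c i != 0 -> exists2 k, (k < m)%N & lam i = lamk k).
  suff /choice[c Hc] : forall i, exists c : R[i],
     (forall x, I x -> u i x = c * phiC nu h (lam i) x) /\
     (c != 0 -> exists2 k, (k < m)%N & lam i = lamk k) by exists c.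
  move=> i; have [/= li ei] := lu i; have [c c1 c2] := cls _ _ ei.
  by exists c; split => // cn; exact: c2.
have cn0 i : c i != 0.
  apply/eqP => ci; have [ui _] := Hc i.
  have /ind/(_ i)/eqP : {ae mu, forall x, I x -> \sum_(j < m.+1) (j == i)%:R * u j x = 0}.
    apply: aeW => x Ix; rewrite (bigD1 i)//= eqxx mul1r ui// ci mul0r add0r.
    by rewrite big1// => j /negPf ->; rewrite mul0r.
  by rewrite eqxx oner_eq0.
have [k Hk] : exists k : 'I_m.+1 -> nat, forall i, (k i < m)%N /\ lam i = lamk (k i).
  suff /choice[k Hk] : forall i, exists k, (k < m)%N /\ lam i = lamk k by exists k.
  by move=> i; have [_ /(_ (cn0 i))[k km e]] := Hc i; exists k.
pose f i : 'I_m := Ordinal (Hk i).1.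
have finj : injective f.
  move=> i j /(congr1 val)/= kij; apply/eqP; apply: contrapT => /negP nij.
  have lij : lam i = lam j by rewrite (Hk i).2 (Hk j).2 kij.
  (* Two multiples of the same phi satisfy c j * u i - c i * u j = 0. *)
  pose d l : R[i] := if l == i then c j else if l == j then - c i else 0.
  have /ind/(_ i) : {ae mu, forall x, I x -> \sum_(l < m.+1) d l * u l x = 0}.
    apply: aeW => x Ix; rewrite (bigD1 i)//= (bigD1 j)/=; last by rewrite eq_sym.
    rewrite big1 ?addr0; last first.
      by move=> l /andP[/negPf li /negPf lj]; rewrite /d li lj mul0r.
    rewrite /d eqxx eq_sym (negPf nij) eqxx.
    rewrite (Hc i).1// (Hc j).1// lij; ring.
  by rewrite /d eqxx => cj0; have := cn0 j; rewrite cj0 eqxx.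
by have := leq_card f finj; rewrite !card_ord ltnn.
Qed.

End Spectrum.

(** * The half line and the interval *)

Section TwoProblems.
Context {R : realType}.
Local Notation mu := (@lebesgue_measure R).
Local Notation normc := ComplexField.Normc.normc.
Variables (nu h : R).
Hypotheses (nu_gt0 : 0 < nu) (h_gt0 : 0 < h).

Lemma kummer_param_level (t : R) : kummer_param nu h (2 * (2 * t + 1 + nu) * h) = - t.
Proof. by rewrite /kummer_param; field; rewrite gt_eqF. Qed.

(** The energy in terms of the Kummer parameter; the values a = -k give the levels
    of the half line. *)
Lemma level_kummer_param (e : R) : e = 2 * (2 * - kummer_param nu h e + 1 + nu) * h.
Proof. by rewrite /kummer_param; field; rewrite gt_eqF. Qed.

Lemma level_lt (s t : R) :
  (2 * (2 * s + 1 + nu) * h < 2 * (2 * t + 1 + nu) * h) = (s < t).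
Proof. by rewrite ltr_pM2r// ltr_pM2l// ltrD2r ltrD2r ltr_pM2l. Qed.

Lemma normcM_phiC (c : R[i]) e x : normc (c * phiC nu h e x) = normc c * `|phi nu h e x|.
Proof. by rewrite ComplexField.Normc.normcM /phiC normc_real. Qed.

Lemma normc_gt0 (c : R[i]) : c != 0 -> 0 < normc c.
Proof.
move=> c0; rewrite lt_neqAle; apply/andP; split; last by case: (c) => p q; exact: sqrtr_ge0.
apply: contra c0 => /eqP/esym c0; apply/eqP; exact: ComplexField.Normc.eq0_normc.
Qed.

(** Square integrability at infinity leaves exactly the parameters a = -k. *)
Theorem halfline_eigenvalue (m : nat) :
  mth_eigenvalue `]0, +oo[ (Q_halfline nu h) m (2 * (2 * m%:R + 1 + nu) * h).
Proof.
have oI : open (`](0 : R), +oo[%classic) by exact: interval_open.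
have cI : is_interval (`](0 : R), +oo[%classic) by exact: interval_is_interval.
have rI : exists2 r : R, 0 < r & `]0, r[ `<=` `]0, +oo[.
  by exists 1 => //; apply: subset_itvl.
apply: (@mth_eigenvalue_of_regular _ nu h nu_gt0 h_gt0 _ _ (fun k => 2 * (2 * k%:R + 1 + nu) * h)) => //.
- by move=> k _; rewrite level_lt ltr_nat.
- move=> k _; split; last exact: phiC_left_bc.
  apply: phiC_eigen => //; apply: (@phi_L2_halfline _ _ _ _ _ _ k) => //.
  exact: kummer_param_level.
move=> e u [Qu bc].
have [c Hc] := eigenfunction_regular nu_gt0 h_gt0 oI cI (@subset_refl _ _) rI Qu bc.
exists c => // c0 em.
have [k ek] : exists k : nat, kummer_param nu h e = - k%:R.
  apply: contrapT => /forallNP nk.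
  have ek k : kummer_param nu h e != - k%:R by apply/eqP; exact: nk.
  apply: (phi_not_L2_halfline nu_gt0 h_gt0 ek).
  have [[_ _ fin] _ _] := Qu.
  have nc := normc_gt0 c0.
  have eI : (\int[mu]_(x in `]0%R, +oo[) (normc (u x) ^+ 2)%:E =
      \int[mu]_(x in `]0%R, +oo[) ((normc c ^+ 2)%:E * (phi nu h e x ^+ 2)%:E))%E.
    apply: eq_integral => x; rewrite inE => Ix.
    by rewrite Hc// -/(phiC nu h e x) normcM_phiC exprMn real_normK ?num_real.
  move: fin; rewrite eI.
  rewrite ge0_integralZl_EFin ?sqr_ge0//.
  - set J := (\int[mu]_(x in _) _)%E => fin; rewrite ltNge; apply/negP => Joo.
    move: fin; have -> : J = +oo%E by apply/eqP; rewrite -leye_eq.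
    by rewrite gt0_muley// lte_fin exprn_gt0.
  - by move=> x _; rewrite lee_fin sqr_ge0.
  - by apply/measurable_EFinP; apply: measurable_funX; exact: measurable_phi.
exists k; last by rewrite {1}(level_kummer_param e) ek opprK.
by move: em; rewrite (level_kummer_param e) ek opprK level_lt ltr_nat.
Qed.

(** The Dirichlet condition reads M(a, nu+1, L^2/h) = 0.  Such an a is negative,
    and lies within 1/2 of some -k; below the level of -m - d m one has k <= m, so
    a is the zero listed for that k. *)
Theorem interval_eigenvalue (m : nat) (L : R) (d : nat -> R) : 0 < L ->
  (forall k, (k <= m)%N -> [/\ 0 < d k, d k <= 2^-1,
     kummer (- k%:R - d k) (nu + 1) (L ^+ 2 / h) = 0 &
     forall d' : R, `|d'| <= 2^-1 ->
       kummer (- k%:R - d') (nu + 1) (L ^+ 2 / h) = 0 -> d' = d k]) ->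
  mth_eigenvalue `]0, L[ (Q_Lambda nu h L) m (2 * (2 * (m%:R + d m) + 1 + nu) * h).
Proof.
move=> L0 Hd.
have oI : open (`](0 : R), L[%classic) by exact: interval_open.
have cI : is_interval (`](0 : R), L[%classic) by exact: interval_is_interval.
have I0 : `]0, L[ `<=` `](0 : R), +oo[ by apply: subset_itvl.
have rI : exists2 r : R, 0 < r & `]0, r[ `<=` `]0, L[ by exists L.
apply: (@mth_eigenvalue_of_regular _ nu h nu_gt0 h_gt0 _ _ (fun k => 2 * (2 * (k%:R + d k) + 1 + nu) * h)) => //.
- move=> k km; rewrite level_lt -natr1.
  have [_ d1 _ _] := Hd k (ltnW km); have [d2 _ _ _] := Hd k.+1 km; lra.
- move=> k km; have [_ _ d0 _] := Hd k km; split; last 1 first.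
  + have f0 : phi nu h (2 * (2 * (k%:R + d k) + 1 + nu) * h) L = 0.
      by apply/(phi_vanish nu h _ L0); rewrite kummer_param_level opprD.
    under eq_fun do rewrite /phiC normc_real.
    rewrite -(normr0 R) -f0; apply: cvg_norm; apply: cvg_at_left_filter.
    exact: phi_continuous.
  + by apply: phiC_eigen => //; exact: phi_L2_bounded.
  + exact: phiC_left_bc.
move=> e u [Qu bc bL].
have [c Hc] := eigenfunction_regular nu_gt0 h_gt0 oI cI I0 rI Qu bc.
exists c => // c0 em.
have fL : phi nu h e L = 0.
  have lim1 : normc c * `|phi nu h e x| @[x --> L^'-] --> normc c * `|phi nu h e L|.
    apply: cvgMr; apply: cvg_norm; apply: cvg_at_left_filter; exact: phi_continuous.
  have lim2 : normc c * `|phi nu h e x| @[x --> L^'-] --> (0 : R).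
    apply: cvg_trans bL; apply: near_eq_cvg; near=> x.
    rewrite Hc -/(phiC nu h e x) ?normcM_phiC//= in_itv/=; apply/andP; split.
      by near: x; exact: nbhs_left_gt.
    by [].
  have /eqP : normc c * `|phi nu h e L| = 0 by exact: (cvg_unique _ lim1 lim2).
  by rewrite mulf_eq0 gt_eqF ?normc_gt0//= normr_eq0 => /eqP.
move/(phi_vanish nu h e L0) : fL; set a := kummer_param nu h e => Ka.
have z0 : 0 <= L ^+ 2 / h by rewrite divr_ge0 ?sqr_ge0// ltW.
have a0 : a < 0.
  rewrite ltNge; apply/negP => a0; have := kummer_gt0 a0 (addr_gt0 nu_gt0 ltr01) z0.
  by rewrite Ka ltxx.
move: em; rewrite {1}(level_kummer_param e) level_lt -/a => am.
(* k is the integer nearest to -a. *)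
have at0 : 0 <= - a + 2^-1 by lra.
set k := Num.truncn (- a + 2^-1).
have /andP[k1 k2] := truncn_itv at0; rewrite -/k -[k.+1%:R]natr1 in k1 k2.
have [dm0 dm1 _ _] := Hd m (leqnn m).
have km : (k <= m)%N.
  by rewrite -ltnS -(ltr_nat R) -[m.+1%:R]natr1; apply: le_lt_trans k1 _; lra.
have [_ _ _ uniq] := Hd k km.
have dk : - a - k%:R = d k.
  apply: uniq; first by rewrite ler_norml; apply/andP; split; lra.
  by have -> : - k%:R - (- a - k%:R) = a by [rewrite opprB addKr opprK]; exact: Ka.
exists k; last by rewrite {1}(level_kummer_param e) -/a -dk; congr (2 * (2 * _ + 1 + nu) * h); ring.
move: km; rewrite leq_eqVlt => /predU1P[kE|//]; exfalso.
by move: am; rewrite -kE -dk; lra.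
Unshelve. all: end_near. Qed.

End TwoProblems.

Theorem corollary1p2 (R : realType) (nu : R) (nu_gt0 : 0 < nu) :
  (forall (m : nat) (h : R), 0 < h ->
     mth_eigenvalue `]0, +oo[ (Q_halfline nu h) m
       (2 * (2 * m%:R + 1 + nu) * h))
  /\
  (forall m : nat, exists eps C : R, 0 < eps /\
     forall L h : R, 0 < L -> 0 < h -> L ^- 2 * h < eps ->
       exists lam r : R,
         [/\ mth_eigenvalue `]0, L[ (Q_Lambda nu h L) m lam,
             `|r| <= C * (L ^- 2 * h) &
             lam = 2 * (2 * m%:R + 1 + nu) * h
                   + 4 * h `^ (- 2 * m%:R - nu)
                     * L `^ (2 * (2 * m%:R + 1 + nu))
                     / (m`!%:R * Gamma (1 + m%:R + nu))
                     * expR (- L ^+ 2 / h) * (1 + r)]).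
Proof.
split=> [m h h0|m]; first exact: halfline_eigenvalue.
have /choice[ZC H] : forall k, exists ZC : R * R, [/\ 1 <= ZC.1, 0 <= ZC.2 &
    forall z, ZC.1 <= z -> exists d, zero_shift nu k z ZC.2 d].
  by move=> k; have [Z [C ?]] := kummer_zero_asymptotics k nu_gt0; exists (Z, C).
(* All the zeros near 0, ..., -m are needed at once; the sum bounds each of the
   m + 1 thresholds, as they are nonnegative. *)
pose Z := \sum_(k < m.+1) (ZC k).1.
have Zk k : (k <= m)%N -> (ZC k).1 <= Z.
  move=> km; rewrite /Z (bigD1 (Ordinal (km : (k < m.+1)%N)))//= lerDl.
  by apply: sumr_ge0 => i _; have [h1 _ _] := H i; exact: le_trans h1.
have Z1 : 1 <= Z by have [h1 _ _] := H m; exact: le_trans h1 (Zk m (leqnn m)).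
exists Z^-1, (ZC m).2; split; first by rewrite invr_gt0 (lt_le_trans ltr01).
move=> L h L0 h0 small; pose z := L ^+ 2 / h.
have z0 : 0 < z by rewrite divr_gt0// exprn_gt0.
have zV : L ^- 2 * h = z^-1 by rewrite /z invf_div mulrC.
have Zz : Z <= z.
  have Z0 : 0 < Z by exact: lt_le_trans Z1.
  by rewrite ltW// -(ltf_pV2 (x := z)) ?posrE// -zV.
have /choice[d Hd] : forall k, exists d, (k <= m)%N -> zero_shift nu k z (ZC k).2 d.
  move=> k; have [km|_] := leqP k m; last by exists 0.
  by have [_ _ /(_ z (le_trans (Zk k km) Zz))[dk ?]] := H k; exists dk.
have [_ _ _ _ cl] := Hd m (leqnn m).
set D := z `^ _ * _ / _ in cl.
have D0 : D != 0.
  have g0 : 0 < Gamma (1 + m%:R + nu).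
    have -> : 1 + m%:R + nu = (m%:R + nu) + 1 by ring.
    by apply: Gamma_gt0; rewrite ltr_wpDl.
  by rewrite gt_eqF// divr_gt0 ?mulr_gt0 ?powR_gt0 ?expR_gt0 ?ltr0n ?fact_gt0.
exists (2 * (2 * (m%:R + d m) + 1 + nu) * h), (d m / D - 1); split.
- by apply: interval_eigenvalue => // k km; have [] := Hd k km.
- by rewrite zV; exact: cl.
have -> : 1 + (d m / D - 1) = d m / D by ring.
have key : h * z `^ (2 * m%:R + 1 + nu) =
    h `^ (- 2 * m%:R - nu) * L `^ (2 * (2 * m%:R + 1 + nu)).
  rewrite /z powRM ?sqr_ge0 ?invr_ge0 ?(ltW h0)//.
  have -> : (L ^+ 2) `^ (2 * m%:R + 1 + nu) = L `^ (2 * (2 * m%:R + 1 + nu)).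
    by rewrite -powR_mulrn ?(ltW L0)// -powRrM.
  rewrite mulrCA mulrC; congr (_ * _).
  rewrite -powR_inv1 ?(ltW h0)// -powRrM -{1}[h]powRr1 ?(ltW h0)//.
  rewrite -powRD ?(gt_eqF h0) ?implybT//; congr (_ `^ _); ring.
have -> : 2 * (2 * (m%:R + d m) + 1 + nu) * h = 2 * (2 * m%:R + 1 + nu) * h + 4 * h * d m by ring.
congr (_ + _).
rewrite -[4 * h `^ _ * _]mulrA -key mulNr -/z.
transitivity (4 * h * (D * (d m / D))); first by rewrite [D * _]mulrCA mulfV ?mulr1.
by rewrite {1}/D; ring.
Qed.
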